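(* Fix a stage $k$, the past data $\mathbf Y_{1:k-1}$, and a receive beamforming matrix $\mathbf W_k=[\mathbf w_{k,1},\dots,\mathbf w_{k,M_R}]\in\mathbb C^{N_R\times M_R}$ (with $\mathbf W_k^{\mathsf H}\mathbf W_k$ invertible), and put $\mathbf R_{\mathbf W_k}=\mathbf W_k(\mathbf W_k^{\mathsf H}\mathbf W_k)^{-1}\mathbf W_k^{\mathsf H}$. Consider the problem $$\text{(A)}\quad \min_{\mathbf R_{\mathbf V}\in\mathbb C^{N_T\times N_T},\ d_1,\dots,d_{3L}\in\mathbb R}\ \sum_{\ell=1}^{3L}d_\ell\quad\text{s.t.}\quad \begin{bmatrix}\mathbf J_k(\mathbf R_{\mathbf V},\mathbf R_{\mathbf W_k})&\sqrt{q_\ell}\,\mathbf e_\ell\\ \sqrt{q_\ell}\,\mathbf e_\ell^{\mathsf T}&d_\ell\end{bmatrix}\succeq 0\ \ \forall \ell,$$ $$\tfrac{M_T}{P}\mathbf R_{\mathbf V}\text{ is an orthogonal projection matrix},\quad \mathrm{rank}(\mathbf R_{\mathbf V})=M_T,\quad \mathbf R_{\mathbf V}\succeq 0 .$$ Let $\tilde{\mathbf\Lambda}^*$ denote the solution (maximizer) of $$\max_{\mathbf\Lambda\in\mathbb R^{3L\times 3L}}\ 2\,\mathrm{tr}(\mathbf\Lambda\mathbf Q^{1/2})-\mathrm{tr}\big(\mathbf\Lambda^{\mathsf T}\mathbf J_{k-1}^{(\mathsf P)}\mathbf\Lambda\big)-\frac{2P}{M_T}\sum_{i=1}^{M_T}\mu_i\big(\tilde{\mathbf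 P}_{\mathbf\Lambda\mathbf\Lambda^{\mathsf T}}\big),$$ where $\tilde{\mathbf P}_{\mathbf\Lambda\mathbf\Lambda^{\mathsf T}}=\sum_{m=1}^{M_R}\mathbb E\big[\dot{\tilde{\mathbf G}}_{k,m}(\boldsymbol\theta)\mathbf\Lambda\mathbf\Lambda^{\mathsf T}\dot{\tilde{\mathbf G}}_{k,m}^{\mathsf H}(\boldsymbol\theta)\,\big|\,\mathbf Y_{1:k-1}\big]$ and $\dot{\tilde{\mathbf G}}_{k,m}(\boldsymbol\theta)=\big[\dot{\mathbf H}_1^{\mathsf H}(\boldsymbol\theta)\mathbf w_{k,m}\ \cdots\ \dot{\mathbf H}_{3L}^{\mathsf H}(\boldsymbol\theta)\mathbf w_{k,m}\big]$, $\mathbf w_{k,m}$ being the $m$-th column of $\mathbf W_k$. If $\mu_{M_T}(\tilde{\mathbf P}_{\tilde{\mathbf\Lambda}^*(\tilde{\mathbf\Lambda}^* )^{\mathsf T}})>\mu_{M_T+1}(\tilde{\mathbf P}_{\tilde{\mathbf\Lambda}^*(\tilde{\mathbf\Lambda}^* )^{\mathsf T}})$, then the semidefinite relaxation of (A), given by $$\min_{\mathbf R_{\mathbf V},\ d_1,\dots,d_{3L}}\ \sum_{\ell=1}^{3L}d_\ell\quad\text{s.t.}\quad \begin{bmatrix}\mathbf J_k(\mathbf R_{\mathbf V},\mathbf R_{\mathbf W_k})&\sqrt{q_\ell}\,\mathbf e_\ell\\ \sqrt{q_\ell}\,\mathbf e_\ell^{\mathsf T}&d_\ell\end{bmatrix}\succeq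 0\ \ \forall \ell,\quad \mathbf 0\preceq\mathbf R_{\mathbf V}\preceq\tfrac{P}{M_T}\mathbf I_{N_T},\quad \mathrm{tr}(\mathbf R_{\mathbf V})\le P,$$ is tight, i.e., it has the same optimal value as (A).
   Context: Notation: $\mu_i(\cdot)$ is the $i$-th largest eigenvalue (with multiplicity) of a Hermitian matrix; $\mathbf e_\ell$ is the $\ell$-th column of $\mathbf I_{3L}$; $\succeq$ is the positive semidefinite order; $\imath=\sqrt{-1}$. Model: integers $L\ge1$, $1\le M_T<N_T$, $1\le M_R<N_R$; power $P>0$; weights $q_1,\dots,q_{3L}\ge 0$ with $\sum_\ell q_\ell=1$, $\mathbf Q=\mathrm{diag}(q_1,\dots,q_{3L})$. The random parameter is $\boldsymbol\theta=[\boldsymbol\phi^{\mathsf T},\mathrm{Re}\,\boldsymbol\alpha^{\mathsf T},\mathrm{Im}\,\boldsymbol\alpha^{\mathsf T}]^{\mathsf T}\in\mathbb R^{3L}$ with prior density $f(\boldsymbol\theta)$: $\phi_i$ is uniform on $[\phi_{\min},\phi_{\max}]$, and $\alpha_i\sim\mathcal{CN}(0,1)$ are i.i.d. and independent of $\boldsymbol\phi$. The response matrix is $\mathbf H(\boldsymbol\theta)=\sum_{i=1}^L\alpha_i\mathbf a_{\rm R}(\phi_i)\mathbf a_{\rm T}^{\mathsf H}(\phi_i)\in\mathbb C^{N_R\times N_T}$, $\mathbf a_{\rm S}(\phi)=[1,e^{\imath\pi\sin\phi},\dots,e^{\imath(N_{\rm S}-1)\pi\sin\phi}]^{\mathsf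 T}$ for ${\rm S}\in\{{\rm R},{\rm T}\}$, and $\dot{\mathbf H}_i(\boldsymbol\theta)=\partial\mathbf H(\boldsymbol\theta)/\partial\theta_i$. Past measurements are $\mathbf Y_\ell=\mathbf W_\ell^{\mathsf H}\mathbf H(\boldsymbol\theta)\mathbf V_\ell+\mathbf W_\ell^{\mathsf H}\mathbf Z_\ell$, $\ell=1,\dots,k-1$, where $\mathbf V_\ell\in\mathbb C^{N_T\times M_T}$, $\mathbf W_\ell\in\mathbb C^{N_R\times M_R}$ (with $\mathbf W_\ell^{\mathsf H}\mathbf W_\ell$ invertible) are known functions of the earlier measurements and $\mathbf Z_\ell$ has i.i.d. $\mathcal{CN}(0,1)$ entries, independent of everything else. $\mathbb E[\cdot\mid\mathbf Y_{1:k-1}]$ is expectation under the posterior of $\boldsymbol\theta$ given $\mathbf Y_{1:k-1}=(\mathbf Y_1,\dots,\mathbf Y_{k-1})$. Bayesian Fisher information matrix (BFIM): for Hermitian $\mathbf R_{\mathbf V}\in\mathbb C^{N_T\times N_T}$, $\mathbf R_{\mathbf W}\in\mathbb C^{N_R\times N_R}$, $\mathbf J_k(\mathbf R_{\mathbf V},\mathbf R_{\mathbf W})=\mathbf J_k^{(\mathsf D)}(\mathbf R_{\mathbf V},\mathbf R_{\mathbf W})+\mathbf J_{k-1}^{(\mathsf P)}$, a $3L\times 3L$ matrix, where $$[\mathbf J_k^{(\mathsf D)}(\mathbf R_{\mathbf V},\mathbf R_{\mathbf W})]_{i,j}=2\,\mathrm{Re}\,\mathrm{tr}\,\mathbb E\big[\mathbf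 R_{\mathbf W}\dot{\mathbf H}_i(\boldsymbol\theta)\mathbf R_{\mathbf V}\dot{\mathbf H}_j^{\mathsf H}(\boldsymbol\theta)\mid\mathbf Y_{1:k-1}\big],\qquad [\mathbf J_{k-1}^{(\mathsf P)}]_{i,j}=-\mathbb E\Big[\tfrac{\partial^2\log f(\boldsymbol\theta\mid\mathbf Y_{1:k-1})}{\partial\theta_i\partial\theta_j}\Big|\mathbf Y_{1:k-1}\Big].$$ $\mathbf J_{k-1}^{(\mathsf P)}$ does not depend on the stage-$k$ beamformers. Standing identifiability assumption: in each stage $k$ there exist transmit and receive beamforming matrices $\mathbf V,\mathbf W$ for which the BFIM $\mathbf J_k(\mathbf V\mathbf V^{\mathsf H},\mathbf W(\mathbf W^{\mathsf H}\mathbf W)^{-1}\mathbf W^{\mathsf H})$ is invertible.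
   Formalization: In P̃ the columns w_{k,m} of W_k are replaced by the columns of any U with U^H U = I and U U^H = R_{W_k} (U = W_k if its columns are orthonormal); with non-orthonormal columns the claim fails, since scaling W_k changes P̃ but not (A) or its relaxation. *)

(* Defs.v *)
(* World: MathComp + MathComp-Analysis, complex numbers R[i] over R : realType. *)
From HB Require Import structures.
From mathcomp Require Import all_boot all_order all_algebra.
From mathcomp Require Import all_classical all_reals all_analysis.
From mathcomp Require Import complex.

Set Implicit Arguments.
Unset Strict Implicit.
Unset Printing Implicit Defensive.

Import Order.TTheory GRing.Theory Num.Theory.
Import numFieldNormedType.Exports.

Local Open Scope ring_scope.
Local Open Scope complex_scope.
Local Open Scope sesquilinear_scope.

Section Linear_algebra.
Context {R : realType}.

Definition toC m n (A : 'M[R]_(m, n)) : 'M[R[i]]_(m, n) :=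
  map_mx (fun x : R => x%:C) A.

(* In R[i], [0 <= z] says that z is real and nonnegative. *)
Definition psdC n (A : 'M[R[i]]_n) : Prop :=
  A \is hermsymmx /\ forall x : 'cV[R[i]]_n, 0 <= (x^t* *m A *m x) 0 0.

Definition psdR n (A : 'M[R]_n) : Prop :=
  A^T = A /\ forall x : 'cV[R]_n, 0 <= (x^T *m A *m x) 0 0.

Definition orth_projection n (A : 'M[R[i]]_n) : Prop :=
  A \is hermsymmx /\ A *m A = A.

(* The i-th largest eigenvalue, with multiplicity and counted from i = 1, of a
   Hermitian matrix: [spectral_diag A] lists the diagonal of a unitary
   diagonalization of A. *)
Definition eig_desc n (i : nat) (A : 'M[R[i]]_n) : R :=
  nth 0 (sort (fun x y : R => y <= x)
           [seq complex.Re (spectral_diag A 0 j) | j <- enum 'I_n]) i.-1.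

(* The orthogonal projection onto the column space of W when W^H W is
   invertible. *)
Definition range_proj m n (W : 'M[R[i]]_(m, n)) : 'M[R[i]]_m :=
  W *m invmx (W^t* *m W) *m W^t*.

End Linear_algebra.

Section Independent_product.
Context {R : realType}.

Definition tcons n (x : measurableTypeR R * n.-tuple (measurableTypeR R)) :
  n.+1.-tuple (measurableTypeR R) := [tuple of x.1 :: x.2].

Lemma measurable_tcons n : measurable_fun setT (@tcons n).
Proof.
exact: (measurable_cons (f := fst) (g := snd) measurable_fst measurable_snd).
Qed.

HB.instance Definition _ n :=
  isMeasurableFun.Build _ _ _ _ (@tcons n) (@measurable_tcons n).

(* The law of independent real random variables X_0, ..., X_(n-1) with
   respective laws P 0, ..., P (n-1). *)
Fixpoint indep_law n : ('I_n -> probability (measurableTypeR R) R) ->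
    probability (n.-tuple (measurableTypeR R)) R :=
  match n with
  | 0 => fun _ => dirac ([tuple] : 0.-tuple (measurableTypeR R))
  | n'.+1 => fun P =>
      distribution (P ord0 \x indep_law (fun i => P (lift ord0 i)))%E (@tcons n')
  end.

End Independent_product.

(* theta = (phi, Re alpha, Im alpha) in R^(3L). *)
Notation dim3 L := (L + (L + L))%N.

Section Model.
Context {R : realType} (L NT NR : nat).
Local Notation C := R[i].
Local Notation param := 'rV[R]_(dim3 L).

Definition phi (theta : param) (i : 'I_L) : R := theta 0 (lshift (L + L) i).
Definition alpha (theta : param) (i : 'I_L) : C :=
  theta 0 (rshift L (lshift L i)) +i* theta 0 (rshift L (rshift L i)).

Definition steer N (x : R) : 'cV[C]_N :=
  \col_n (cos (n%:R * pi * sin x) +i* sin (n%:R * pi * sin x)).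

Definition response (theta : param) : 'M[C]_(NR, NT) :=
  \sum_(i < L) alpha theta i *:
     (steer NR (phi theta i) *m (steer NT (phi theta i))^t*).

Definition pderiv (f : param -> R) (i : 'I_(dim3 L)) (theta : param) : R :=
  'D_('e_i) f theta.

Definition dresponse (i : 'I_(dim3 L)) (theta : param) : 'M[C]_(NR, NT) :=
  \matrix_(a, b)
    (pderiv (fun t => complex.Re (response t a b)) i theta
     +i* pderiv (fun t => complex.Im (response t a b)) i theta).

(* The angles are i.i.d. uniform; alpha_i ~ CN(0,1) means that its real and
   imaginary parts are independent N(0, 1/2), of standard deviation
   sqrt (1/2). *)
Context (phimin phimax : R) (hphi : phimin < phimax).

Definition prior_marginal (j : 'I_(dim3 L)) :
    probability (measurableTypeR R) R :=
  match fintype.split j with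
  | inl _ => uniform_prob hphi
  | inr _ => normal_prob 0 (Num.sqrt 2^-1)
  end.

Definition prior_law : probability ((dim3 L).-tuple (measurableTypeR R)) R :=
  indep_law prior_marginal.

Definition prior_mean (g : param -> R) : R :=
  (\int[prior_law]_t g (\row_j tnth t j))%R.

(* The density f(theta) of prior_law with respect to Lebesgue measure. *)
Definition prior_pdf (theta : param) : R :=
  \prod_(j < dim3 L)
     match fintype.split j with
     | inl _ => uniform_pdf phimin phimax (theta 0 j)
     | inr _ => normal_pdf 0 (Num.sqrt 2^-1) (theta 0 j)
     end.

Section Posterior.
Context (MT MR : nat).
(* [Vpol h] and [Wpol h] are the beamformers used right after the measurements
   listed in h; Y lists the past measurements Y_1, ..., Y_(k-1). *)
Context (Vpol : seq 'M[C]_(MR, MT) -> 'M[C]_(NT, MT))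
        (Wpol : seq 'M[C]_(MR, MT) -> 'M[C]_(NR, MR))
        (Y : seq 'M[C]_(MR, MT)).

(* The density at y of W^H H(theta) V + W^H Z, where Z has i.i.d. CN(0,1)
   entries: the columns of W^H Z are independent CN(0, W^H W) vectors. *)
Definition stage_pdf (V : 'M[C]_(NT, MT)) (W : 'M[C]_(NR, MR))
    (y : 'M[C]_(MR, MT)) (theta : param) : R :=
  let S := W^t* *m W in
  let D := y - W^t* *m response theta *m V in
  expR (- complex.Re (\tr (D^t* *m invmx S *m D)))
  / (pi ^+ (MR * MT) * complex.Re (\det S) ^+ MT).

Definition likelihood (theta : param) : R :=
  \prod_(l < size Y)
     stage_pdf (Vpol (take l Y)) (Wpol (take l Y)) (nth 0 Y l) theta.

Definition evidence : R := prior_mean likelihood.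

(* Bayes' rule: f(theta | Y_(1:k-1)), and expectation under the posterior. *)
Definition post_pdf (theta : param) : R :=
  prior_pdf theta * likelihood theta / evidence.

Definition post_mean (g : param -> R) : R :=
  prior_mean (fun theta => g theta * likelihood theta) / evidence.

Definition post_mean_mx m n (g : param -> 'M[C]_(m, n)) : 'M[C]_(m, n) :=
  \matrix_(a, b) (post_mean (fun t => complex.Re (g t a b))
                  +i* post_mean (fun t => complex.Im (g t a b))).

Definition JD (RV : 'M[C]_NT) (RW : 'M[C]_NR) : 'M[R]_(dim3 L) :=
  \matrix_(i, j)
    (2 * complex.Re (\tr (post_mean_mx (fun t =>
       RW *m dresponse i t *m RV *m (dresponse j t)^t*)))).

Definition JP : 'M[R]_(dim3 L) :=
  \matrix_(i, j)
    (- post_mean (pderiv (pderiv (fun t => ln (post_pdf t)) j) i)).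

Definition J (RV : 'M[C]_NT) (RW : 'M[C]_NR) : 'M[R]_(dim3 L) :=
  JD RV RW + JP.

Definition identifiable : Prop :=
  exists (V : 'M[C]_(NT, MT)) (W : 'M[C]_(NR, MR)),
    W^t* *m W \in unitmx /\ J (V *m V^t*) (range_proj W) \in unitmx.

Context (q : 'I_(dim3 L) -> R) (P : R).

Definition lmi_block (RV : 'M[C]_NT) (RW : 'M[C]_NR) (l : 'I_(dim3 L))
    (d : R) : 'M[R]_(dim3 L + 1) :=
  let e : 'cV[R]_(dim3 L) := Num.sqrt (q l) *: delta_mx l 0 in
  block_mx (J RV RW) e e^T d%:M.

Definition feasible_A (RW : 'M[C]_NR) (RV : 'M[C]_NT)
    (d : 'I_(dim3 L) -> R) : Prop :=
  [/\ forall l, psdR (lmi_block RV RW l (d l)),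
      orth_projection ((MT%:R / P)%:C *: RV),
      \rank RV = MT &
      psdC RV].

Definition feasible_SDR (RW : 'M[C]_NR) (RV : 'M[C]_NT)
    (d : 'I_(dim3 L) -> R) : Prop :=
  [/\ forall l, psdR (lmi_block RV RW l (d l)),
      psdC RV,
      psdC ((P / MT%:R)%:C%:M - RV) &
      \tr RV <= P%:C].

(* +oo when nothing is feasible. *)
Definition optimal_value
    (feasible : 'M[C]_NT -> ('I_(dim3 L) -> R) -> Prop) : \bar R :=
  ereal_inf [set v | exists RV d, feasible RV d /\ v = (\sum_l d l)%:E]%classic.

(* [W] has the columns w_1, ..., w_MR. *)
Definition Gdot (W : 'M[C]_(NR, MR)) (m : 'I_MR) (theta : param) :
    'M[C]_(NT, dim3 L) :=
  \matrix_(a, i) ((dresponse i theta)^t* *m col m W) a 0.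

Definition Ptilde (W : 'M[C]_(NR, MR)) (A : 'M[R]_(dim3 L)) : 'M[C]_NT :=
  \sum_(m < MR) post_mean_mx (fun t =>
     Gdot W m t *m toC A *m (Gdot W m t)^t*).

Definition Qsqrt : 'M[R]_(dim3 L) := diag_mx (\row_l Num.sqrt (q l)).

Definition dual_objective (W : 'M[C]_(NR, MR)) (Lam : 'M[R]_(dim3 L)) : R :=
  2 * \tr (Lam *m Qsqrt) - \tr (Lam^T *m JP *m Lam)
  - 2 * P / MT%:R *
    \sum_(1 <= i < MT.+1) eig_desc i (Ptilde W (Lam *m Lam^T)).

End Posterior.
End Model.

(* Main.v *)
Require Import Defs.
From HB Require Import structures.
From mathcomp Require Import all_boot all_order all_algebra.
From mathcomp Require Import all_classical all_reals all_analysis.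
From mathcomp Require Import measurable_realfun.
From mathcomp Require Import complex.
From mathcomp Require Import ring lra.

(* Write mu_i for the i-th largest eigenvalue, g for the dual objective and P_X
   for its linear matrix argument, X = Lam Lam^T. Since
   tr (X J^D(R_V)) = 2 Re tr (R_V P_X), Ky Fan's inequality makes g(Lam) a lower
   bound for the relaxation, for every Lam. Conversely, at the maximizer Lam the
   eigenvalue gap makes X |-> sum_(i <= M_T) mu_i(P_X) differentiable, with
   gradient given by the top eigenprojection Pi of P_X. With R_V = (P / M_T) Pi
   and M = J(R_V), first-order optimality reads M Lam = Q^(1/2). Moreover M is
   positive semidefinite: if Lam is singular, test the perturbations
   Lam + t v u^T with Lam u = 0; if Lam is invertible, comparing Lam with Lam O,
   O orthogonal, shows that Lam^T M Lam = Lam^T Q^(1/2) >= 0. Hence R_V and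
   d_l = sqrt(q_l) Lam_(l,l) are feasible for (A), with value
   tr (Lam Q^(1/2)) = g(Lam). If J^P is not symmetric, both problems are
   infeasible.

   The linearity of posterior means rests on the integrability of products of
   two derivatives of the response, which have linear growth, against a bounded
   likelihood and a prior with finite second moments. *)

Set Implicit Arguments.
Unset Strict Implicit.
Unset Printing Implicit Defensive.

Import Order.TTheory GRing.Theory Num.Theory.
Import numFieldNormedType.Exports.

Local Open Scope ring_scope.
Local Open Scope complex_scope.
Local Open Scope sesquilinear_scope.

(** * Hermitian matrices over R[i] *)

Section ReIm.
Context {R : realType}.
Implicit Types z w : R[i].

Lemma cReD z w : complex.Re (z + w) = complex.Re z + complex.Re w.
Proof. by case: z; case: w. Qed.

Lemma cImD z w : complex.Im (z + w) = complex.Im z + complex.Im w.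
Proof. by case: z; case: w. Qed.

Lemma cReN z : complex.Re (- z) = - complex.Re z.
Proof. by case: z. Qed.

Lemma cImN z : complex.Im (- z) = - complex.Im z.
Proof. by case: z. Qed.

Lemma cReM z w : complex.Re (z * w) =
  complex.Re z * complex.Re w - complex.Im z * complex.Im w.
Proof. by case: z; case: w. Qed.

Lemma cImM z w : complex.Im (z * w) =
  complex.Re z * complex.Im w + complex.Im z * complex.Re w.
Proof. by case: z; case: w. Qed.

Lemma cRe_conj z : complex.Re (z^*)%R = complex.Re z.
Proof. by case: z. Qed.

Lemma cIm_conj z : complex.Im (z^*)%R = - complex.Im z.
Proof. by case: z. Qed.

Lemma cRe_realM (x : R) z : complex.Re (x%:C * z) = x * complex.Re z.
Proof. by rewrite cReM /= mul0r subr0. Qed.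

Lemma cIm_realM (x : R) z : complex.Im (x%:C * z) = x * complex.Im z.
Proof. by rewrite cImM /= mul0r addr0. Qed.

Lemma cRe_sum (I : Type) (r : seq I) (p : pred I) (F : I -> R[i]) :
  complex.Re (\sum_(i <- r | p i) F i) = \sum_(i <- r | p i) complex.Re (F i).
Proof. exact: (big_morph _ cReD erefl). Qed.

Lemma cIm_sum (I : Type) (r : seq I) (p : pred I) (F : I -> R[i]) :
  complex.Im (\sum_(i <- r | p i) F i) = \sum_(i <- r | p i) complex.Im (F i).
Proof. exact: (big_morph _ cImD erefl). Qed.

Lemma conj_real (x : R) : ((x%:C : R[i])^*)%R = x%:C.
Proof. exact: conjc_real. Qed.

Lemma Re_ge0 z : 0 <= z -> 0 <= complex.Re z.
Proof. by rewrite lecE => /andP[]. Qed.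

End ReIm.

Section Hermitian.
Context {R : realType}.
Local Notation C := R[i].

Definition retr n (A : 'M[C]_n) : R := complex.Re (\tr A).

Lemma retrD n (A B : 'M[C]_n) : retr (A + B) = retr A + retr B.
Proof. by rewrite /retr raddfD cReD. Qed.

Lemma retrN n (A : 'M[C]_n) : retr (- A) = - retr A.
Proof. by rewrite /retr raddfN cReN. Qed.

Lemma retr_sum n (I : Type) (r : seq I) (F : I -> 'M[C]_n) :
  retr (\sum_(i <- r) F i) = \sum_(i <- r) retr (F i).
Proof.
apply: (big_morph _ (@retrD n)).
by rewrite /retr mxtrace0.
Qed.

Lemma retrZ n (a : R) (A : 'M[C]_n) : retr (a%:C *: A) = a * retr A.
Proof. by rewrite /retr linearZ /= cRe_realM. Qed.

Lemma retrC m n (A : 'M[C]_(m, n)) (B : 'M[C]_(n, m)) :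
  retr (A *m B) = retr (B *m A).
Proof. by rewrite /retr mxtrace_mulC. Qed.

Lemma hermP n (A : 'M[C]_n) : reflect (A^t* = A) (A \is hermsymmx).
Proof.
by apply: (iffP (is_hermitianmxP _ _ _)); rewrite expr0 scale1r => /esym.
Qed.

Lemma ctr_mul m n p (A : 'M[C]_(m, n)) (B : 'M[C]_(n, p)) :
  (A *m B)^t* = B^t* *m A^t*.
Proof. by rewrite trmx_mul map_mxM. Qed.

Lemma ctrK m n (A : 'M[C]_(m, n)) : A^t*^t* = A.
Proof. exact: trmxCK. Qed.

Lemma ctrD m n (A B : 'M[C]_(m, n)) : (A + B)^t* = A^t* + B^t*.
Proof. by rewrite raddfD map_mxD. Qed.

Lemma ctrN m n (A : 'M[C]_(m, n)) : (- A)^t* = - A^t*.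
Proof. by rewrite raddfN map_mxN. Qed.

Lemma ctrZ m n (a : R) (A : 'M[C]_(m, n)) :
  (a%:C *: A)^t* = a%:C *: A^t*.
Proof. by rewrite linearZ map_mxZ /= conj_real. Qed.

Lemma ctr1 n : (1%:M : 'M[C]_n)^t* = 1%:M.
Proof. by rewrite trmx1 map_mx1. Qed.

Lemma retr_ctr n (A : 'M[C]_n) : retr (A^t*) = retr A.
Proof.
rewrite /retr /mxtrace !cRe_sum; apply: eq_bigr => i _.
by rewrite !mxE cRe_conj.
Qed.

Lemma retr_normal_ge0 m n (A : 'M[C]_(m, n)) : 0 <= retr (A^t* *m A).
Proof.
apply: Re_ge0; apply: sumr_ge0 => i _; rewrite mxE; apply: sumr_ge0 => j _.
by rewrite !mxE mulrC mul_conjC_ge0.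
Qed.

Lemma retr_sandwich_sym m n (A : 'M[C]_m) (B : 'M[C]_n) (X Y : 'M[C]_(m, n)) :
  A \is hermsymmx -> B \is hermsymmx ->
  retr (A *m X *m B *m Y^t*) = retr (A *m Y *m B *m X^t*).
Proof.
move=> /hermP hA /hermP hB.
have -> : retr (A *m X *m B *m Y^t*) = retr (Y *m B *m X^t* *m A).
  by rewrite -[LHS]retr_ctr !ctr_mul ctrK hA hB !mulmxA.
by rewrite retrC !mulmxA.
Qed.

Lemma mulmx_row_col m n p (A : 'M[C]_(m, n)) (B : 'M[C]_(n, p)) i j :
  (A *m B) i j = (row i A *m col j B) 0 0.
Proof. by rewrite !mxE; apply: eq_bigr => k _; rewrite !mxE. Qed.

Lemma retr_frame m n (U : 'M[C]_(m, n)) (K : 'M[C]_m) :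
  retr (U *m U^t* *m K) =
  \sum_j complex.Re (((col j U)^t* *m K *m col j U) 0 0).
Proof.
rewrite -mulmxA retrC /retr /mxtrace cRe_sum; apply: eq_bigr => j _.
rewrite mulmx_row_col row_mul; have -> // : row j (U^t*) = (col j U)^t*.
by apply/rowP => a; rewrite !mxE.
Qed.

Lemma psdC_normal m n (A : 'M[C]_(m, n)) : psdC (A^t* *m A).
Proof.
split; first by apply/hermP; rewrite ctr_mul ctrK.
move=> x; rewrite !mulmxA -mulmxA -ctr_mul mxE; apply: sumr_ge0 => j _.
by rewrite !mxE mulrC mul_conjC_ge0.
Qed.

Lemma orth_projection_psd n (A : 'M[C]_n) : orth_projection A -> psdC A.
Proof. by case=> /hermP hA idA; rewrite -idA -{1}hA; apply: psdC_normal. Qed.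

Lemma orth_projection_compl n (A : 'M[C]_n) :
  orth_projection A -> orth_projection (1%:M - A).
Proof.
case=> /hermP hA idA; split.
  by apply/hermP; rewrite ctrD ctrN ctr1 hA.
by rewrite mulmxBl mul1mx mulmxBr mulmx1 idA subrr subr0.
Qed.

Lemma psdCZ n (a : R) (A : 'M[C]_n) : 0 <= a -> psdC A -> psdC (a%:C *: A).
Proof.
move=> a0 [/hermP hA pA]; split; first by apply/hermP; rewrite ctrZ hA.
move=> x; rewrite -scalemxAr -scalemxAl mxE mulr_ge0 //.
by rewrite ler0c.
Qed.

Lemma idem_mxtrace (F : fieldType) n (A : 'M[F]_n) :
  A *m A = A -> \tr A = (\rank A)%:R.
Proof.
move=> idA; set r := \rank A.
have eA := mulmx_base A.
have RC1 : row_base A *m col_base A = 1%:M.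
  apply: (row_free_inj (row_base_free A)).
  have := idA; rewrite -{1 2 3}eA -mulmxA => /(row_full_inj (col_base_full A)).
  by rewrite mul1mx mulmxA.
by rewrite -[in LHS]eA mxtrace_mulC RC1 mxtrace1.
Qed.

(* Expanding [0 <= |B - a D|^2]. *)
Lemma retr_mul_le n (B D : 'M[C]_n) (a : R) : B \is hermsymmx ->
  D \is hermsymmx ->
  2 * a * retr (B *m D) <= retr (B *m B) + a ^+ 2 * retr (D *m D).
Proof.
move=> /hermP hB /hermP hD.
have := retr_normal_ge0 (B - a%:C *: D).
rewrite ctrD ctrN ctrZ hB hD mulmxBl !mulmxBr -!scalemxAl -!scalemxAr.
rewrite !retrD !retrN retrD !retrZ retrN !retrZ (retrC D B); nra.
Qed.

Lemma desc_sort_top n (k : nat) (d : 'I_n -> R) :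
  let s := sort (fun x y : R => y <= x) [seq d j | j <- enum 'I_n] in
  (0 < k < n)%N ->
  exists T : {set 'I_n}, [/\ #|T| = k,
    \sum_(j in T) d j = \sum_(1 <= i < k.+1) nth 0 s i.-1,
    forall j, j \in T -> nth 0 s k.-1 <= d j &
    forall j, j \notin T -> d j <= nth 0 s k].
Proof.
move=> s /andP[k0 kn].
set leR := fun x y : R => y <= x.
have tot : total leR by move=> x y; exact: le_total.
have tr : transitive leR by move=> x y z /= xy yz; exact: le_trans yz xy.
pose e := sort (relpre d leR) (enum 'I_n).
have es : s = map d e by rewrite /s sort_map.
have se : size e = n by rewrite size_sort size_enum_ord.
have ue : uniq e by rewrite sort_uniq enum_uniq.
have ss : size s = n by rewrite es size_map.
have srt : sorted leR s by exact: sort_sorted.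
have mono i j : (i <= j)%N -> (j < n)%N -> nth 0 s j <= nth 0 s i.
  move=> ij jn; apply: (sorted_leq_nth tr) => //.
  - by move=> x; exact: lexx.
  - by rewrite inE ss (leq_ltn_trans ij).
  - by rewrite inE ss.
have memT j : (j \in [set x in take k e]) = (index j e < k)%N.
  by rewrite inE in_take // mem_sort mem_enum.
have ltj j : (index j e < n)%N 
    by rewrite -[X in (_ < X)%N]se index_mem mem_sort mem_enum.
have dj j : d j = nth 0 s (index j e).
  by rewrite es (nth_map j) ?se ?ltj // nth_index // mem_sort mem_enum.
exists [set x in take k e]; split.
- rewrite cardsE (card_uniqP _) ?take_uniq // size_take se kn //.
- have -> : \sum_(j in [set x in take k e]) d j = \sum_(j <- take k e) d j.
    rewrite [RHS]big_uniq ?take_uniq //; apply: eq_bigl => j.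
    by rewrite inE.
  rewrite -(big_map d xpredT id) map_take -es big_add1 /=.
  rewrite (big_nth 0) size_take ss kn.
  by apply: eq_big_nat => i /andP[_ ik]; rewrite nth_take.
- by move=> j; rewrite memT => jk; rewrite dj mono //;
    [rewrite -ltnS prednK|rewrite (leq_ltn_trans (leq_pred k))].
- by move=> j; rewrite memT -leqNgt => jk; rewrite dj mono.
Qed.

Lemma spectral_decomp n (A : 'M[C]_n) : A \is hermsymmx ->
  let U := spectralmx A in
  A = U^t* *m diag_mx (\row_j (complex.Re (spectral_diag A 0 j))%:C) *m U.
Proof.
move=> hA U.
have /orthomx_spectralP eA := hermitian_normalmx hA.
have eD : \row_j (complex.Re (spectral_diag A 0 j))%:C = spectral_diag A.
  apply/rowP => j; rewrite mxE; apply: RRe_real.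
  by have /mxOverP := hermitian_spectral_diag_real hA; exact.
by rewrite eD /U -invmx_unitary ?spectral_unitarymx.
Qed.

Lemma retr_unitary_diag n (U : 'M[C]_n) (c : 'I_n -> R) (B : 'M[C]_n) :
  retr (U^t* *m diag_mx (\row_j (c j)%:C) *m U *m B) =
  \sum_j c j * complex.Re ((U *m B *m U^t*) j j).
Proof.
rewrite -!mulmxA retrC -!mulmxA /retr /mxtrace cRe_sum.
by apply: eq_bigr => j _; rewrite mul_diag_mx mxE mxE cRe_realM.
Qed.

Lemma spectral_top n (k : nat) (A : 'M[C]_n) : (0 < k < n)%N ->
  A \is hermsymmx ->
  exists Pi : 'M[C]_n, [/\ orth_projection Pi, \tr Pi = k%:R,
    retr (A *m Pi) = \sum_(1 <= i < k.+1) eig_desc i A &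
    forall B : 'M[C]_n, psdC B -> psdC (1%:M - B) ->
      eig_desc k A * (k%:R - retr (Pi *m B)) -
      eig_desc k.+1 A * (retr B - retr (Pi *m B)) <=
      retr (A *m Pi) - retr (A *m B) /\
      0 <= retr (Pi *m B) <= retr B].
Proof.
move=> kn hA; set U := spectralmx A.
pose d j : R := complex.Re (spectral_diag A 0 j).
have eA : A = U^t* *m diag_mx (\row_j (d j)%:C) *m U by exact: spectral_decomp.
have uU : U *m U^t* = 1%:M by apply/unitarymxP; exact: spectral_unitarymx.
have Uu : U^t* *m U = 1%:M by apply: mulmx1C.
have [T [cT sT geT leT]] := desc_sort_top d kn.
pose c j : R := (j \in T)%:R.
pose Pi := U^t* *m diag_mx (\row_j (c j)%:C) *m U.
have diagPi j : complex.Re ((U *m Pi *m U^t*) j j) = c j.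
  rewrite /Pi !mulmxA uU mul1mx -mulmxA uU mulmx1 !mxE eqxx mulr1n //.
have rAPi : retr (A *m Pi) = \sum_(j in T) d j.
  rewrite {1}eA retr_unitary_diag [RHS]big_mkcond; apply: eq_bigr => j _.
  by rewrite diagPi /c; case: (j \in T); rewrite ?mulr1 ?mulr0.
exists Pi; split.
- split.
    apply/hermP; rewrite !ctr_mul ctrK /Pi !mulmxA; congr (_ *m _ *m _).
    rewrite tr_diag_mx map_diag_mx; congr diag_mx; apply/rowP => j.
    by rewrite !mxE /= conj_real.
  pose Dc : 'M[C]_n := diag_mx (\row_j (c j)%:C).
  have DD : Dc *m Dc = Dc.
    rewrite mulmx_diag; congr diag_mx; apply/rowP => j.
    by rewrite !mxE /c; case: (j \in T); rewrite -?rmorphM ?mulr1 ?mulr0.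
  have -> : Pi *m Pi = U^t* *m (Dc *m (U *m U^t*) *m Dc) *m U.
    by rewrite /Pi -/Dc !mulmxA.
  by rewrite uU mulmx1 DD.
- rewrite /Pi mxtrace_mulC mulmxA uU mul1mx mxtrace_diag -cT.
  rewrite (eq_bigr (fun j => if j \in T then 1 else 0)).
    by rewrite -big_mkcond /= sumr_const.
  by move=> j _; rewrite mxE /c; case: (j \in T).
- by rewrite rAPi sT.
- move=> B [hB pB] [hB' pB'].
  pose p j := complex.Re ((U *m B *m U^t*) j j).
  have pj j (D : 'M[C]_n) :
      ((row j U)^t*^t* *m D *m (row j U)^t*) 0 0 = (U *m D *m U^t*) j j.
    rewrite ctrK -!row_mul !mxE; apply: eq_bigr => i _; rewrite !mxE.
    by congr (_ * _).
  have p0 j : 0 <= p j by apply: Re_ge0; rewrite -pj.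
  have p1 j : 0 <= 1 - p j.
    have := Re_ge0 (pB' ((row j U)^t*)).
    rewrite pj mulmxBr mulmx1 mulmxBl uU !mxE eqxx cReD cReN /=.
    by rewrite /p !mxE.
  have rB : retr B = \sum_j p j.
    rewrite -[B in LHS]mul1mx -Uu -mulmxA retrC /retr /mxtrace cRe_sum.
    by [].
  have rPB : retr (Pi *m B) = \sum_(j in T) p j.
    rewrite retr_unitary_diag [RHS]big_mkcond; apply: eq_bigr => j _.
    by rewrite /c /p; case: (j \in T); rewrite ?mul1r ?mul0r.
  have rBT : retr B - retr (Pi *m B) = \sum_(j in ~: T) p j.
    rewrite rB rPB (bigID (mem T)) /= [X in X - _]addrC addrK.
    apply: eq_bigl => j.
    by rewrite inE.
  have rAB : retr (A *m B) =
      \sum_(j in T) d j * p j + \sum_(j in ~: T) d j * p j.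
    rewrite eA retr_unitary_diag (bigID (mem T)) /=; congr (_ + _).
    by apply: eq_bigl => j; rewrite inE.
  have kT : k%:R - retr (Pi *m B) = \sum_(j in T) (1 - p j).
    by rewrite rPB sumrB sumr_const cT.
  split; last first.
    rewrite -(subr_ge0 _ (retr B)) rBT rPB !sumr_ge0 // => *; exact: p0.
  rewrite rAB opprD addrA rAPi -sumrB rBT kT !mulr_sumr lerB //.
    apply: ler_sum => j jT; 
    have -> : d j - d j * p j = d j * (1 - p j) by ring.
    by rewrite ler_wpM2r // geT.
  apply: ler_sum => j; rewrite inE => jT.
  by rewrite ler_wpM2r // leT.
Qed.

Lemma spectral_diag_ge0 n (A : 'M[C]_n) (j : 'I_n) : psdC A ->
  0 <= complex.Re (spectral_diag A 0 j).
Proof.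
move=> [hA pA]; set U := spectralmx A; have eA := spectral_decomp hA.
have uU : U *m U^t* = 1%:M by apply/unitarymxP; exact: spectral_unitarymx.
have <- : complex.Re ((U *m A *m U^t*) j j) = complex.Re (spectral_diag A 0 j).
  by rewrite {1}eA -/U !mulmxA uU mul1mx -mulmxA uU mulmx1 !mxE eqxx mulr1n.
have := Re_ge0 (pA ((row j U)^t*)).
rewrite ctrK -!row_mul !mxE; congr (0 <= complex.Re _).
by apply: eq_bigr => i _; rewrite !mxE.
Qed.

Lemma eig_desc_ge0 n (k : nat) (A : 'M[C]_n) : psdC A -> 0 <= eig_desc k A.
Proof.
move=> pA; rewrite /eig_desc; set s := sort _ _.
have [ks|ks] := ltnP k.-1 (size s); last by rewrite nth_default.
have := mem_nth 0 ks; rewrite mem_sort => /mapP[j _ ->].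
exact: spectral_diag_ge0.
Qed.

Lemma det_psd_ge0 n (A : 'M[C]_n) : psdC A -> 0 <= complex.Re (\det A).
Proof.
move=> pA; have eA := spectral_decomp pA.1.
set U := spectralmx A in eA.
have uU : U *m U^t* = 1%:M by apply/unitarymxP; exact: spectral_unitarymx.
rewrite eA !det_mulmx mulrC mulrA -det_mulmx uU det1 mul1r det_diag.
rewrite (eq_bigr (fun j => (complex.Re (spectral_diag A 0 j))%:C)).
  rewrite -rmorph_prod /=; apply: prodr_ge0 => j _; exact: spectral_diag_ge0.
by move=> j _; rewrite mxE.
Qed.

Lemma psdCD n (A B : 'M[C]_n) : psdC A -> psdC B -> psdC (A + B).
Proof.
move=> [/hermP hA pA] [/hermP hB pB]; split.
  by apply/hermP; rewrite ctrD hA hB.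
by move=> x; rewrite mulmxDr mulmxDl mxE addr_ge0.
Qed.

Lemma psdC0 n : psdC (0 : 'M[C]_n).
Proof.
by split=> [|x]; [apply/hermP; rewrite trmx0 map_mx0|rewrite mulmx0 mul0mx mxE].
Qed.

End Hermitian.

(** * Duality *)

Section Ky_Fan.
Context {R : realType} (n k : nat) (hk : (0 < k < n)%N).
Local Notation C := R[i].
Local Notation topsum A := (\sum_(1 <= i < k.+1) eig_desc i A).

Lemma Ky_Fan_le (A B : 'M[C]_n) : psdC A ->
  eig_desc k.+1 A <= eig_desc k A ->
  psdC B -> psdC (1%:M - B) -> retr B <= k%:R -> retr (A *m B) <= topsum A.
Proof.
move=> hA hgap pB pB' rB.
have [Pi [_ _ <- /(_ B pB pB') [hPi /andP[a0 ar]]]] := spectral_top hk hA.1.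
have := eig_desc_ge0 k hA; nra.
Qed.

(* For the top projection [Pi'] of [A + B], the gap bounds the loss
   [tr A Pi - tr A Pi'] below by [gap / 2 * |Pi - Pi'|^2], which absorbs the
   gain [tr B (Pi' - Pi)] up to a term quadratic in [B]. *)
Lemma topsum_perturb (A : 'M[C]_n) : A \is hermsymmx ->
  eig_desc k.+1 A < eig_desc k A ->
  exists Pi : 'M[C]_n, exists c : R,
    [/\ orth_projection Pi, \tr Pi = k%:R, 0 <= c,
      retr (A *m Pi) = topsum A &
      forall B : 'M[C]_n, B \is hermsymmx ->
        topsum (A + B) <= topsum A + retr (Pi *m B) + c * retr (B *m B)].
Proof.
move=> hA hgap.
have [Pi [pPi tPi eA hPi]] := spectral_top hk hA.
set d := eig_desc k A - eig_desc k.+1 A.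
have d0 : 0 < d by rewrite subr_gt0.
exists Pi, (2 * d)^-1; split=> //.
  by rewrite invr_ge0; lra.
move=> B hB.
have hAB : A + B \is hermsymmx.
  by apply/hermP; rewrite ctrD (hermP _ hA) (hermP _ hB).
have [Pi' [pPi' tPi' <- _]] := spectral_top hk hAB.
have [h1 _] := hPi Pi' (orth_projection_psd pPi')
  (orth_projection_psd (orth_projection_compl pPi')).
rewrite -eA.
have rk (Q : 'M[C]_n) : \tr Q = k%:R -> retr Q = k%:R.
  move=> tQ; rewrite /retr tQ -(rmorph_nat (real_complex R)) //.
have hD : Pi' - Pi \is hermsymmx.
  by apply/hermP; rewrite ctrD ctrN (hermP _ pPi.1) (hermP _ pPi'.1).
have := retr_mul_le d hB hD.
rewrite mulmxBr [in X in _ <= _ + _ * X]mulmxBl !mulmxBr.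
rewrite mulmxDl !retrD !retrN !retrD !retrN pPi.2 pPi'.2 (retrC Pi' Pi).
rewrite (retrC B Pi) (rk _ tPi) (rk _ tPi').
rewrite (rk _ tPi') in h1.
set s := retr (Pi *m Pi') in h1 *; set b := retr (B *m B).
move=> h2.
have -> : (2 * d)^-1 * b = b / d / 2 by field; lra.
have h3 : 2 * (retr (B *m Pi') - retr (Pi *m B)) - 2 * d * (k%:R - s) <= b / d.
  rewrite ler_pdivlMr //; move: h2; lra.
move: h1 h3; rewrite -mulrBl -/d; lra.
Qed.

End Ky_Fan.

Section Stationary.
Context {R : realType} (N : nat).

Lemma ler0_small (a K : R) : (forall t, 0 < t <= 1 -> a <= K * t) -> a <= 0.
Proof.
move=> h; rewrite leNgt; apply/negP => a0.
have aK : a <= K by have := h 1; rewrite mulr1; apply; rewrite ltr01 lexx.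
have K0 : 0 < K by lra.
have := h (a / (2 * K)).
have -> : K * (a / (2 * K)) = a / 2 by field; lra.
rewrite divr_gt0 ?mulr_gt0 // ler_pdivrMr ?mulr_gt0 // => /(_ _); lra.
Qed.

Lemma mxtrace_normal_eq0 m n (E : 'M[R]_(m, n)) : \tr (E^T *m E) <= 0 -> E = 0.
Proof.
have -> : \tr (E^T *m E) = \sum_j \sum_i E i j ^+ 2.
  apply: eq_bigr => j _; rewrite mxE; apply: eq_bigr => i _.
  by rewrite mxE expr2.
have s0 j : 0 <= \sum_i E i j ^+ 2 by apply: sumr_ge0 => i _; exact: sqr_ge0.
move=> h; apply/matrixP => i j; rewrite mxE.
have /eqP : \sum_j \sum_i E i j ^+ 2 = 0.
  by apply/eqP; rewrite eq_le h /= sumr_ge0.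
rewrite psumr_eq0 // => /allP /(_ j); rewrite mem_index_enum => /(_ isT) /=.
rewrite psumr_eq0 => [|i' _]; last exact: sqr_ge0.
by move=> /allP /(_ i); rewrite mem_index_enum => /(_ isT) /=;
  rewrite sqrf_eq0 => /eqP.
Qed.

Lemma psd_of_local_max (M Q Lam : 'M[R]_N) (c : R) (n2 : 'M[R]_N -> R) :
  M^T = M -> Q^T = Q -> 0 <= c ->
  (forall a Y, n2 (a *: Y) = a ^+ 2 * n2 Y) ->
  (forall Y Z, Y^T = Y -> Z^T = Z -> n2 (Y + Z) <= 2 * n2 Y + 2 * n2 Z) ->
  (forall Lam', 2 * \tr (Lam' *m Q) - \tr (Lam' *m Lam'^T *m M)
     - c * n2 (Lam' *m Lam'^T - Lam *m Lam^T) <=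
     2 * \tr (Lam *m Q) - \tr (Lam *m Lam^T *m M)) ->
  M *m Lam = Q /\ psdR M.
Proof.
move=> hM hQ c0 n2Z n2D hmax.
have st : M *m Lam = Q.
  apply/esym/eqP; rewrite -subr_eq0; apply/eqP/mxtrace_normal_eq0.
  move eE : (Q - M *m Lam) => E.
  pose S := Lam *m E^T + E *m Lam^T; pose T := E *m E^T.
  have hS : S^T = S by rewrite /S linearD /= !trmx_mul !trmxK addrC.
  have hT : T^T = T by rewrite /T trmx_mul trmxK.
  have eqE : 2 * \tr (E^T *m E) = 2 * \tr (E *m Q) - \tr (S *m M).
    have e1 : \tr (E *m Q) = \tr (E^T *m Q).
      by rewrite -mxtrace_tr trmx_mul hQ mxtrace_mulC.
    have e2 : \tr (Lam *m E^T *m M) = \tr (E^T *m (M *m Lam)).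
      by rewrite -mulmxA mxtrace_mulC mulmxA.
    have e3 : \tr (E *m Lam^T *m M) = \tr (E^T *m (M *m Lam)).
      rewrite -mxtrace_tr !trmx_mul trmxK hM mulmxA mxtrace_mulC //.
    have -> : \tr (S *m M) = \tr (Lam *m E^T *m M) + \tr (E *m Lam^T *m M).
      by rewrite /S mulmxDl raddfD.
    have -> : \tr (E^T *m E) = \tr (E^T *m Q) - \tr (E^T *m (M *m Lam)).
      by rewrite -{2}eE mulmxBr raddfB.
    rewrite e1 e2 e3; ring.
  suff H : forall t : R, 0 < t <= 1 -> 2 * \tr (E^T *m E) <=
      (`|\tr (T *m M)| + c * (2 * `|n2 S| + 2 * `|n2 T|)) * t.
    by have := ler0_small H; lra.
  move=> t /andP[t0 t1].
  have := hmax (Lam + t *: E).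
  have -> : (Lam + t *: E) *m (Lam + t *: E)^T =
      Lam *m Lam^T + (t *: S + t ^+ 2 *: T).
    have -> : (Lam + t *: E)^T = Lam^T + t *: E^T by rewrite linearD linearZ.
    rewrite mulmxDl !mulmxDr -!scalemxAl -!scalemxAr.
    by rewrite /S /T scalerDr scalerA expr2 !addrA.
  rewrite [_ + _ - Lam *m Lam^T]addrC addKr !mulmxDl !mxtraceD.
  rewrite -!scalemxAl !mxtraceZ.
  move=> h2; have h1 : n2 (t *: S + t ^+ 2 *: T) <=
      2 * (t ^+ 2 * n2 S) + 2 * (t ^+ 2 ^+ 2 * n2 T).
    by rewrite -!n2Z; apply: n2D; rewrite linearZ /= ?hS ?hT.
  have h3 : t * (2 * \tr (E^T *m E)) <= t ^+ 2 * \tr (T *m M) +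
      c * (2 * (t ^+ 2 * n2 S) + 2 * (t ^+ 2 ^+ 2 * n2 T)).
    have := ler_wpM2l c0 h1; rewrite eqE; lra.
  have t21 : t ^+ 2 <= 1 by rewrite expr_le1 // ltW.
  have b1 : t ^+ 2 * \tr (T *m M) <= t ^+ 2 * `|\tr (T *m M)|.
    by rewrite ler_wpM2l ?sqr_ge0 // ler_norm.
  have b2 : t ^+ 2 * n2 S <= t ^+ 2 * `|n2 S|.
    by rewrite ler_wpM2l ?sqr_ge0 // ler_norm.
  have b3 : t ^+ 2 ^+ 2 * n2 T <= t ^+ 2 * `|n2 T|.
    apply: (@le_trans _ _ (t ^+ 2 ^+ 2 * `|n2 T|)).
      by rewrite ler_wpM2l ?sqr_ge0 // ler_norm.
    rewrite ler_wpM2r // expr2 ger_pMr // exprn_gt0 //.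
  rewrite -(ler_pM2l t0); apply: (le_trans h3).
  have -> : t * ((`|\tr (T *m M)| + c * (2 * `|n2 S| + 2 * `|n2 T|)) * t) =
    t ^+ 2 * `|\tr (T *m M)| +
    c * (2 * (t ^+ 2 * `|n2 S|) + 2 * (t ^+ 2 * `|n2 T|)) by ring.
  by rewrite lerD // ler_wpM2l //; lra.
split=> //; split=> // v.
have [uL|nuL] := boolP (Lam \in unitmx).
  move ew : (invmx Lam *m v) => w.
  have -> : v = Lam *m w by rewrite -ew mulmxA mulmxV // mul1mx.
  rewrite trmx_mul -!mulmxA (mulmxA M) st mulmxA.
  have -> : (w^T *m Lam^T *m (Q *m w)) 0 0 = \tr (w^T *m Lam^T *m (Q *m w)).
    by rewrite /mxtrace big_ord1.
  rewrite -mxtrace_tr !trmx_mul !trmxK hQ.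
  have -> : \tr (w^T *m Q *m (Lam *m w)) = \tr (w *m w^T *m Q *m Lam).
    by rewrite !mulmxA mxtrace_mulC !mulmxA.
  pose ww := (w^T *m w) 0 0.
  have eww : w^T *m w = ww%:M by rewrite [LHS]mx11_scalar.
  have [w0|wn0] := eqVneq w 0.
    by rewrite w0 !mul0mx mxtrace0.
  have ww0 : 0 < ww.
    rewrite ltNge; apply/negP => h; move/eqP: wn0; apply.
    apply: mxtrace_normal_eq0; by rewrite /mxtrace big_ord1.
  pose O := 1%:M - (2 / ww) *: (w *m w^T).
  have OT : O^T = O.
    by rewrite /O linearB linearZ /= trmx1 trmx_mul trmxK.
  have OO : O *m O = 1%:M.
    rewrite /O mulmxBl mul1mx mulmxBr mulmx1 -!scalemxAl -!scalemxAr.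
    rewrite scalerA mulmxA -(mulmxA w) eww mul_mx_scalar -scalemxAl scalerA.
    have -> : 2 / ww * (2 / ww) * ww = 2 / ww + 2 / ww by field; rewrite gt_eqF.
    by rewrite scalerDl opprB [_ + _ - _]addrK subrK.
  have := hmax (Lam *m O).
  have -> : Lam *m O *m (Lam *m O)^T = Lam *m Lam^T.
    by rewrite trmx_mul OT mulmxA -(mulmxA Lam O O) OO mulmx1.
  rewrite subrr.
  have -> : n2 0 = 0 by rewrite -(scale0r (0 : 'M[R]_N)) n2Z expr0n mul0r.
  rewrite /O mulmxBr mulmx1 mulmxBl raddfB /= -scalemxAr -scalemxAl linearZ /=.
  have -> : \tr (Lam *m (w *m w^T) *m Q) = \tr (w *m (w^T *m (Q *m Lam))).
    by rewrite -mulmxA mxtrace_mulC !mulmxA.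
  rewrite !mulmxA => h.
  have : 0 <= 2 / ww * \tr (w *m w^T *m Q *m Lam) by lra.
  by rewrite pmulr_rge0 // divr_gt0.
(* a singular Lam leaves room to add a multiple of v v^T to Lam Lam^T *)
have [u u0 Lu] : exists2 u : 'cV[R]_N, u != 0 & Lam *m u = 0.
  have : kermx Lam^T != 0.
    rewrite kermx_eq0 -row_leq_rank -ltnNge ltn_neqAle rank_leq_row andbT.
    by move: nuL; rewrite -unitmx_tr -row_free_unit /row_free.
  case/rowV0Pn => r /sub_kermxP hr r0; exists r^T.
    by apply: contra r0 => /eqP h; rewrite -(trmxK r) h trmx0.
  by rewrite -[Lam]trmxK -trmx_mul hr trmx0.
pose uu := (u^T *m u) 0 0.
have euu : u^T *m u = uu%:M by rewrite [LHS]mx11_scalar.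
have uu0 : 0 < uu.
  rewrite ltNge; apply/negP => h; move/eqP: u0; apply.
  by apply: mxtrace_normal_eq0; rewrite /mxtrace big_ord1.
pose V := v *m v^T.
have tV : \tr (V *m M) = (v^T *m M *m v) 0 0.
  by rewrite /V -mulmxA mxtrace_mulC /mxtrace big_ord1.
have key t : - (t ^+ 2 * uu * \tr (V *m M)) - c * (t ^+ 2 * uu) ^+ 2 * n2 V
    + 2 * (t * \tr (v *m u^T *m Q)) <= 0.
  have := hmax (Lam + t *: (v *m u^T)).
  have -> : (Lam + t *: (v *m u^T)) *m (Lam + t *: (v *m u^T))^T =
      Lam *m Lam^T + (t ^+ 2 * uu) *: V.
    have -> : (Lam + t *: (v *m u^T))^T = Lam^T + t *: (v *m u^T)^T.
      by rewrite linearD linearZ.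
    rewrite mulmxDl !mulmxDr -!scalemxAl -!scalemxAr.
    rewrite trmx_mul trmxK !mulmxA Lu mul0mx scaler0 addr0.
    rewrite -(mulmxA v u^T) -trmx_mul Lu trmx0 mulmx0 scaler0 add0r.
    rewrite -(mulmxA v u^T u) euu mul_mx_scalar -scalemxAl !scalerA.
    by congr (_ + _ *: _); ring.
  rewrite [_ + _ - Lam *m Lam^T]addrC addKr !mulmxDl !mxtraceD.
  rewrite -!scalemxAl !mxtraceZ n2Z; lra.
rewrite -tV -oppr_le0; apply: (@ler0_small _ (c * uu * `|n2 V|)).
move=> t /andP[t0 t1].
have := key t; have := key (- t); rewrite sqrrN => k1 k2.
have : - (t ^+ 2 * uu * \tr (V *m M)) <= c * (t ^+ 2 * uu) ^+ 2 * n2 V by lra.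
have -> : - (t ^+ 2 * uu * \tr (V *m M)) = (t ^+ 2 * uu) * - \tr (V *m M).
  by ring.
have -> : c * (t ^+ 2 * uu) ^+ 2 * n2 V =
    (t ^+ 2 * uu) * (c * uu * n2 V * t ^+ 2) by ring.
rewrite ler_pM2l ?mulr_gt0 ?exprn_gt0 // => h.
apply: (le_trans h).
rewrite -!(mulrA (c * uu)) ler_wpM2l ?mulr_ge0 ?(ltW uu0) //.
apply: (@le_trans _ _ (`|n2 V| * t ^+ 2)).
  by rewrite ler_wpM2r ?sqr_ge0 // ler_norm.
by rewrite ler_wpM2l // expr2 ger_pMr.
Qed.

End Stationary.

Section Bordered.
Context {R : realType} (N : nat).
Implicit Types (u w : 'cV[R]_N) (A B : 'M[R]_1).

Let mx00D A B : (A + B) 0 0 = A 0 0 + B 0 0. Proof. by rewrite mxE. Qed.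
Let mx00Z a A : (a *: A) 0 0 = a * A 0 0. Proof. by rewrite mxE. Qed.

Lemma mul_tr_delta (s : R) (l : 'I_N) w :
  ((s *: delta_mx l 0 : 'cV[R]_N)^T *m w) 0 0 = s * w l 0.
Proof. by rewrite linearZ /= trmx_delta -scalemxAl -rowE !mxE. Qed.

Lemma tr_mul_delta (s : R) (l : 'I_N) w :
  (w^T *m (s *: delta_mx l 0 : 'cV[R]_N)) 0 0 = s * w l 0.
Proof. by rewrite -mul_tr_delta -[in RHS](trmxK w) -trmx_mul [RHS]mxE. Qed.

Definition bordered (M : 'M[R]_N) (s : R) (l : 'I_N) (d : R) : 'M[R]_(N + 1) :=
  let e : 'cV[R]_N := s *: delta_mx l 0 in block_mx M e e^T d%:M.

Lemma bordered_quad (M : 'M[R]_N) (s d t : R) (l : 'I_N) u :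
  let y := col_mx u (t%:M : 'M[R]_1) in
  (y^T *m bordered M s l d *m y) 0 0 =
  (u^T *m M *m u) 0 0 + 2 * t * s * u l 0 + d * t ^+ 2.
Proof.
rewrite /bordered tr_col_mx mul_row_block mul_row_col !mulmxDl tr_scalar_mx.
rewrite !mul_scalar_mx !mul_mx_scalar -!scalemxAl.
by rewrite !(mx00D, mx00Z) mul_tr_delta tr_mul_delta !mxE eqxx mulr1n; ring.
Qed.

Lemma psdR_bordered (M : 'M[R]_N) (s : R) (l : 'I_N) w :
  psdR M -> M *m w = s *: delta_mx l 0 ->
  psdR (bordered M s l (s * w l 0)).
Proof.
move=> [hM pM] Mw; split.
  by rewrite /bordered tr_block_mx hM trmxK tr_scalar_mx.
move=> y; rewrite -(vsubmxK y); set u := usubmx y.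
have -> : dsubmx y = (dsubmx y 0 0)%:M by rewrite [LHS]mx11_scalar.
move: (dsubmx y 0 0) => t; rewrite bordered_quad.
have := pM (u + t *: w).
have wM : w^T *m M = (s *: delta_mx l 0 : 'cV[R]_N)^T.
  by rewrite -Mw trmx_mul hM.
have -> : (u + t *: w)^T = u^T + t *: w^T by rewrite linearD linearZ.
rewrite mulmxDl -scalemxAl wM mulmxDl !mulmxDr -!scalemxAr.
rewrite -[u^T *m M *m w]mulmxA Mw -!scalemxAl !(mx00D, mx00Z).
rewrite !mul_tr_delta tr_mul_delta; lra.
Qed.

End Bordered.

Section Tightness.
Context {R : realType} (N NT MT : nat) (hMT : (0 < MT < NT)%N).
Context (P : R) (P0 : 0 < P) (q : 'I_N -> R).
Context (JP : 'M[R]_N) (JD : 'M[R[i]]_NT -> 'M[R]_N).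
Context (PT : 'M[R]_N -> 'M[R[i]]_NT).
Hypothesis PT_lin : forall a X Y, PT (a *: X + Y) = a%:C *: PT X + PT Y.
Hypothesis PT_herm : forall X, X^T = X -> PT X \is hermsymmx.
Hypothesis PT_psd : forall A : 'M[R]_N, psdC (PT (A *m A^T)).
Hypothesis JD_PT : forall X B, \tr (X *m JD B) = 2 * retr (B *m PT X).
Hypothesis JD_sym : forall B, B \is hermsymmx -> (JD B)^T = JD B.

Local Notation J B := (JD B + JP).
Local Notation Q := (diag_mx (\row_l Num.sqrt (q l))).
Local Notation topsum A := (\sum_(1 <= i < MT.+1) eig_desc i A).
Local Notation block B l d := (bordered (J B) (Num.sqrt (q l)) l d).
Let obj (A : 'M[R]_N) : R :=
  2 * \tr (A *m Q) - \tr (A^T *m JP *m A) -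
  2 * P / MT%:R * topsum (PT (A *m A^T)).

Let m0 : 0 < MT%:R :> R.
Proof. by rewrite ltr0n; case/andP: hMT. Qed.

Let PTD X Y : PT (X + Y) = PT X + PT Y.
Proof. by rewrite -[X in LHS]scale1r PT_lin rmorph1 scale1r. Qed.

Let PT0 : PT 0 = 0.
Proof.
by have := PTD 0 0; rewrite addr0 => /eqP; rewrite -subr_eq subrr => /eqP.
Qed.

Let PTZ a X : PT (a *: X) = a%:C *: PT X.
Proof. by rewrite -[a *: X]addr0 PT_lin PT0 addr0. Qed.

Lemma projection_SDR_feasible (B : 'M[R[i]]_NT) :
  orth_projection ((MT%:R / P)%:C *: B) -> \rank B = MT -> psdC B ->
  psdC ((P / MT%:R)%:C%:M - B) /\ \tr B <= P%:C.
Proof.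
set Pi := _ *: B => pPi rB pB.
have eB : B = (P / MT%:R)%:C *: Pi.
  rewrite /Pi scalerA -rmorphM /= (_ : P / MT%:R * (MT%:R / P) = 1) ?scale1r //.
  by field; rewrite !gt_eqF.
have c0 : 0 <= P / MT%:R by rewrite divr_ge0 ?ltW.
split.
  rewrite eB -scalemx1 -scalerBr; apply: (psdCZ c0).
  exact/orth_projection_psd/orth_projection_compl.
have rPi : \rank Pi = MT.
  rewrite /Pi mxrank_scale_nz // -(rmorph0 (real_complex R)).
  by rewrite (inj_eq (@complexI _)) mulf_neq0 ?invr_eq0 ?gt_eqF.
rewrite eB linearZ /= (idem_mxtrace pPi.2) rPi -(rmorph_nat (real_complex R)).
by rewrite -rmorphM /= divfK ?gt_eqF.
Qed.

Lemma weak_duality (A : 'M[R]_N) (B : 'M[R[i]]_NT) (d : 'I_N -> R) :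
  eig_desc MT.+1 (PT (A *m A^T)) <= eig_desc MT (PT (A *m A^T)) ->
  (forall l, psdR (block B l (d l))) -> psdC B ->
  psdC ((P / MT%:R)%:C%:M - B) -> \tr B <= P%:C ->
  obj A <= \sum_l d l.
Proof.
move=> hgap hB pB pB' tB.
have h1 : 2 * \tr (A *m Q) - \tr (A^T *m J B *m A) <= \sum_l d l.
  have -> : \tr (A *m Q) = \sum_l Num.sqrt (q l) * A l l.
    by apply: eq_bigr => l _; rewrite mul_mx_diag !mxE mulrC.
  have -> : \tr (A^T *m J B *m A) =
      \sum_l ((col l A)^T *m J B *m col l A) 0 0.
    apply: eq_bigr => l _; rewrite tr_col -row_mul colE mulmxA -colE.
    rewrite !mxE; apply: eq_bigr => j _; rewrite !mxE //.
  rewrite mulr_sumr -sumrB; apply: ler_sum => l _.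
  have := (hB l).2 (col_mx (col l A) (-1)%:M).
  by rewrite bordered_quad [col l A l 0]mxE; lra.
apply: le_trans h1; rewrite /obj.
have -> : \tr (A^T *m J B *m A) =
    2 * retr (B *m PT (A *m A^T)) + \tr (A^T *m JP *m A).
  rewrite mulmxDr mulmxDl mxtraceD -JD_PT; congr (_ + _).
  by rewrite mxtrace_mulC !mulmxA.
suff : 2 * retr (B *m PT (A *m A^T)) <= 2 * P / MT%:R * topsum (PT (A *m A^T)).
  lra.
pose B' := (MT%:R / P)%:C *: B.
have eB : B = (P / MT%:R)%:C *: B'.
  rewrite /B' scalerA -rmorphM /= (_ : P / MT%:R * (MT%:R / P) = 1) ?scale1r //.
  by field; rewrite !gt_eqF.
have c0 : 0 < MT%:R / P by rewrite divr_gt0.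
have pB1 : psdC B' by exact: psdCZ (ltW c0) pB.
have pB2 : psdC (1%:M - B').
  have := psdCZ (ltW c0) pB'; rewrite scalerBr -/B' scale_scalar_mx -rmorphM /=.
  by rewrite (_ : MT%:R / P * (P / MT%:R) = 1) //; field; rewrite !gt_eqF.
have tB1 : retr B' <= MT%:R.
  rewrite retrZ; have /andP[_ h] : (complex.Im P%:C == complex.Im (\tr B)) &&
    (retr B <= P) by rewrite -lecE.
  have h2 : MT%:R / P * P = MT%:R by field; rewrite gt_eqF.
  by rewrite -[leRHS]h2 ler_wpM2l // ltW.
have ky := Ky_Fan_le hMT (PT_psd A) hgap pB1 pB2 tB1.
rewrite {1}eB -scalemxAl retrZ (retrC B').
have := ler_wpM2l (ltW (divr_gt0 P0 m0)) ky.
rewrite (_ : 2 * P / MT%:R = 2 * (P / MT%:R)); last by rewrite mulrA.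
rewrite -(mulrA 2).
set x := _ * retr _; set y := _ * topsum _; lra.
Qed.

Lemma tight (A : 'M[R]_N) : JP^T = JP ->
  (forall A', obj A' <= obj A) ->
  eig_desc MT.+1 (PT (A *m A^T)) < eig_desc MT (PT (A *m A^T)) ->
  exists B : 'M[R[i]]_NT, exists d : 'I_N -> R,
    [/\ forall l, psdR (block B l (d l)),
        orth_projection ((MT%:R / P)%:C *: B),
        \rank B = MT, psdC B & \sum_l d l = obj A].
Proof.
move=> hJP hmax hgap; set X := A *m A^T.
have symX (A' : 'M[R]_N) : (A' *m A'^T)^T = A' *m A'^T.
  by rewrite trmx_mul trmxK.
have [Pi [c [pPi tPi c0 eA hc]]] :=
  topsum_perturb hMT (PT_herm (symX A)) hgap.
have rk : \rank Pi = MT.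
  have := idem_mxtrace pPi.2; rewrite tPi => /eqP.
  by rewrite eqr_nat => /eqP.
pose r := P / MT%:R.
have r0 : 0 < r by rewrite divr_gt0.
pose B := r%:C *: Pi.
have pB : psdC B by apply: psdCZ (ltW r0) _; exact: orth_projection_psd.
have r'r : MT%:R / P * r = 1 by rewrite /r; field; rewrite !gt_eqF.
have eB : (MT%:R / P)%:C *: B = Pi.
  by rewrite /B scalerA -rmorphM /= r'r scale1r.
have rB : \rank B = MT.
  rewrite /B mxrank_scale_nz // -(rmorph0 (real_complex R)).
  by rewrite (inj_eq (@complexI _)) gt_eqF.
pose M := J B; pose n2 Y := retr (PT Y *m PT Y).
have hM : M^T = M by rewrite /M linearD /= hJP (JD_sym pB.1).
have trM (A' : 'M[R]_N) : \tr (A' *m A'^T *m M) =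
    2 * r * retr (Pi *m PT (A' *m A'^T)) + \tr (A'^T *m JP *m A').
  rewrite /M mulmxDr mxtraceD JD_PT /B -scalemxAl retrZ mulrA; congr (_ + _).
  by rewrite -!mulmxA mxtrace_mulC !mulmxA.
have objA : obj A = 2 * \tr (A *m Q) - \tr (A *m A^T *m M).
  by rewrite /obj trM -eA retrC /r; ring.
have [|||||st psdM] := @psd_of_local_max R N M Q A (2 * r * c) n2 hM.
- by rewrite tr_diag_mx.
- by rewrite !mulr_ge0 // ltW.
- move=> a Z; rewrite /n2 PTZ -scalemxAl -scalemxAr !retrZ; ring.
- move=> Y Z hY hZ; rewrite /n2 PTD mulmxDl !mulmxDr !retrD.
  have := retr_mul_le 1 (PT_herm hY) (PT_herm hZ).
  by rewrite (retrC (PT Z)); lra.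
- move=> A'; rewrite -objA; apply: le_trans (hmax A').
  rewrite trM /obj.
  pose Y := A' *m A'^T - X.
  have hY : Y^T = Y by rewrite /Y linearB /= !symX.
  have := hc _ (PT_herm hY); rewrite -PTD -/X addrC subrK.
  rewrite -/(n2 Y) => h.
  have h2 : retr (Pi *m PT (A' *m A'^T)) =
      retr (Pi *m PT X) + retr (Pi *m PT Y).
    by rewrite -retrD -mulmxDr -PTD addrC subrK.
  have h3 : topsum (PT (A' *m A'^T)) <= retr (Pi *m PT (A' *m A'^T)) + c * n2 Y.
    by rewrite h2 (retrC Pi (PT X)) eA.
  have := ler_wpM2l (ltW r0) h3; rewrite -/Y -/r.
  have -> : 2 * P / MT%:R * topsum (PT (A' *m A'^T)) =
    2 * (r * topsum (PT (A' *m A'^T))) by rewrite /r; ring.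
  lra.
have stl l : M *m col l A = Num.sqrt (q l) *: delta_mx l 0.
  rewrite colE mulmxA -colE st; apply/colP => j; rewrite !mxE eqxx andbT eq_sym.
  by case: eqP => [->|_]; rewrite ?mulr1n ?mulr1 ?mulr0n ?mulr0.
exists B, (fun l => Num.sqrt (q l) * (col l A) l 0); split=> //.
- by move=> l; exact: psdR_bordered.
- by rewrite eB.
- rewrite objA.
  have -> : \tr (A *m A^T *m M) = \tr (A *m Q).
    rewrite -mulmxA; congr (\tr (A *m _)).
    by rewrite -hM -trmx_mul st tr_diag_mx.
  have -> : 2 * \tr (A *m Q) - \tr (A *m Q) = \tr (A *m Q) by ring.
  by apply: eq_bigr => l _; rewrite mul_mx_diag !mxE mulrC.
Qed.

End Tightness.

(** * Moments and integrability *)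

Section Second_moments.
Context {R : realType}.
Local Notation mu := (@lebesgue_measure R).

Lemma integral_density (nu : probability (measurableTypeR R) R) (p g : R -> R) :
  nu `<< mu -> measurable_fun setT p -> (forall x, 0 <= p x) ->
  (forall A, measurable A -> nu A = \int[mu]_(x in A) (p x)%:E)%E ->
  measurable_fun setT g -> (forall x, 0 <= g x) ->
  (\int[nu]_x (g x)%:E = \int[mu]_x (g x * p x)%:E)%E.
Proof.
move=> numu mp p0 hp mg g0.
pose f := Radon_Nikodym_SigmaFinite.f nu mu.
have f0 := Radon_Nikodym_SigmaFinite.f_ge0 numu.
have fi := Radon_Nikodym_SigmaFinite.f_integrable numu.
have mg' : measurable_fun setT (EFin \o g) by exact/measurable_EFinP.
have mp' : measurable_fun setT (EFin \o p) by exact/measurable_EFinP.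
have g0' x : (0 <= (EFin \o g) x)%E by rewrite lee_fin.
have := Radon_Nikodym_SigmaFinite.change_of_variables numu g0'
  (measurableT : measurable (setT : set (measurableTypeR R))) mg'.
rewrite /= => <-.
apply: ge0_ae_eq_integral => //.
- by apply: emeasurable_funM => //; exact: measurable_int fi.
- by apply/measurable_EFinP; exact: measurable_funM.
- by move=> x _; apply: mule_ge0; [exact: g0'|exact: f0].
- by move=> x _; rewrite lee_fin mulr_ge0.
- have : ae_eq mu setT f (EFin \o p).
    apply: integral_ae_eq => // E _ mE.
    by rewrite -hp // -(Radon_Nikodym_SigmaFinite.f_integral numu).
  by apply: filterS => x /= h _; rewrite EFinM; congr (_ * _)%E; exact: (h I).
Qed.

Lemma normal_second_moment (m : R) : m != 0 ->
  (\int[normal_prob 0 m]_x (x ^+ 2)%:E < +oo)%E.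
Proof.
move=> m0.
have m2 : 0 < m ^+ 2 by rewrite exprn_even_gt0.
pose m' := Num.sqrt 2 * m.
have m'0 : m' != 0 by rewrite mulf_neq0 // gt_eqF // sqrtr_gt0.
have m'2 : m' ^+ 2 = 2 * m ^+ 2 by rewrite exprMn sqr_sqrtr.
have mX : measurable_fun setT (fun x : R => x ^+ 2) by exact: measurable_funX.
rewrite (@integral_density (normal_prob 0 m) (normal_pdf 0 m)
  (fun x => x ^+ 2)); last 6 first.
- exact: normal_prob_dominates.
- exact: measurable_normal_pdf.
- by move=> x; exact: normal_pdf_ge0.
- by [].
- by [].
- by move=> x; exact: sqr_ge0.
pose K := normal_peak m * (4 * m ^+ 2) / normal_peak m'.
have pk : 0 < normal_peak m by exact: normal_peak_gt0.
have pk' : 0 < normal_peak m' by exact: normal_peak_gt0.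
apply: (@le_lt_trans _ _ (\int[mu]_x (K * normal_pdf 0 m' x)%:E)%E).
  apply: ge0_le_integral => //.
  - by move=> x _; rewrite lee_fin mulr_ge0 ?sqr_ge0 ?normal_pdf_ge0.
  - apply/measurable_EFinP; apply: measurable_funM => //.
    exact: measurable_normal_pdf.
  - apply/measurable_EFinP; apply: measurable_funM => //.
    exact: measurable_normal_pdf.
  - move=> x _; rewrite lee_fin /normal_pdf (negbTE m0) (negbTE m'0).
    rewrite /normal_fun subr0.
    set y := x ^+ 2 / (4 * m ^+ 2).
    have -> : - x ^+ 2 / (m ^+ 2 *+ 2) = - y + - y by rewrite /y; field; lra.
    have -> : - x ^+ 2 / (m' ^+ 2 *+ 2) = - y by rewrite m'2 /y; field; lra.
    have -> : x ^+ 2 = 4 * m ^+ 2 * y by rewrite /y; field; lra.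
    have -> : K * (normal_peak m' * expR (- y)) =
      normal_peak m * (4 * m ^+ 2) * expR (- y) by rewrite /K; field; lra.
    have y0 : 0 <= y by rewrite divr_ge0 ?sqr_ge0 //; lra.
    have h : y * expR (- y) <= 1.
      rewrite expRN ler_pdivrMr ?expR_gt0 // mul1r.
      have := expR_ge1Dx y; lra.
    rewrite expRD; have := expR_gt0 (- y); move: h.
    set e := expR (- y); set n := normal_peak m => h e0.
    have : y * e * e <= 1 * e by rewrite ler_pM2r.
    have : 0 < n * (4 * m ^+ 2) by apply: mulr_gt0 => //; lra.
    move=> h1 h2; have := ler_wpM2l (ltW h1) h2; lra.
under eq_integral do rewrite EFinM.
rewrite integralZl //; last exact: integrable_normal_pdf.
by rewrite integral_normal_pdf mule1 ltry.
Qed.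

Lemma uniform_second_moment (a b : R) (ab : a < b) :
  (\int[uniform_prob ab]_x (x ^+ 2)%:E < +oo)%E.
Proof.
have mX : measurable_fun setT (fun x : R => (x ^+ 2)%:E).
  by apply/measurable_EFinP; exact: measurable_funX.
have sqr_le (x : R) : a <= x -> x <= b -> x ^+ 2 <= a ^+ 2 + b ^+ 2.
  by move=> ax xb; have [x0|x0] := leP 0 x; nra.
rewrite integral_uniform //; last by move=> x; rewrite lee_fin sqr_ge0.
have : (\int[mu]_(x in `[a, b]) (x ^+ 2)%:E <=
        (a ^+ 2 + b ^+ 2)%:E * mu `[a, b])%E.
  rewrite -integral_cst //; apply: ge0_le_integral => //.
  - by move=> x _; rewrite lee_fin sqr_ge0.
  - exact: measurable_funTS.
  - move=> x /=; rewrite in_itv /= => /andP[ax xb]; rewrite lee_fin.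
    exact: sqr_le.
rewrite lebesgue_measure_itv /= lte_fin ab -EFinB -EFinM => h.
apply: (@le_lt_trans _ _ ((b - a)^-1%:E * ((a ^+ 2 + b ^+ 2) * (b - a))%:E)%E).
  by apply: lee_wpmul2l => //; rewrite lee_fin invr_ge0; lra.
by rewrite -EFinM ltry.
Qed.

Lemma integral_indep_law_tnth n (P : 'I_n -> probability (measurableTypeR R) R)
    (j : 'I_n) (f : R -> \bar R) :
  measurable_fun setT f -> (forall x, 0 <= f x)%E ->
  (\int[indep_law P]_t f (tnth t j) = \int[P j]_x f x)%E.
Proof.
move=> mf f0; elim: n P j => [P [] //|n IH P j].
have mt m (i : 'I_m) : measurable_fun setT
    (fun t : m.-tuple (measurableTypeR R) => f (tnth t i)).
  exact: (measurableT_comp mf (measurable_tnth i)).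
rewrite [indep_law P]/= /distribution.
rewrite (ge0_integral_pushforward (@measurable_tcons R n)) //; last first.
  exact: (mt _ j).
rewrite preimage_setT fubini_tonelli1 //=; last first.
  exact: (measurableT_comp (mt _ j) (@measurable_tcons R n)).
rewrite /fubini_F.
have [->|[j' ->]] : j = ord0 \/ exists j', j = lift ord0 j'.
  by case: (unliftP ord0 j) => [j' ->|->]; [right; exists j'|left].
  apply: eq_integral => x _ /=.
  under eq_integral do rewrite (tnth_nth x) /=.
  by rewrite integral_cst //= probability_setT mule1.
under eq_integral => x _.
  under eq_integral do rewrite /comp tnthS /=.
  rewrite IH; over.
by rewrite integral_cst //= probability_setT mule1.
Qed.

End Second_moments.

Section Growth.
Context {R : realType}.

Lemma is_derive1_comp (f g : R -> R) (x df dg : R) :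
  is_derive (g x) 1 f df -> is_derive x 1 g dg ->
  is_derive x 1 (f \o g) (df * dg).
Proof.
move=> hf hg.
have df1 : derivable f (g x) 1 by exact: ex_derive.
have dg1 : derivable g x 1 by exact: ex_derive.
apply: DeriveDef.
  by apply/derivable1_diffP/differentiable_comp; exact/derivable1_diffP.
by rewrite -derive1E derive1_comp // !derive1E !derive_val.
Qed.

Lemma derive_measurable (f f' : R -> R) :
  (forall x : R, is_derive x 1 f (f' x)) -> measurable_fun setT f.
Proof.
move=> h; apply: continuous_measurable_fun => x.
by apply/differentiable_continuous/derivable1_diffP; exact: ex_derive.
Qed.

Definition bounded1 (f : R -> R) :=
  measurable_fun setT f /\ exists K, forall x, `|f x| <= K.

Lemma bounded1D (f g : R -> R) : bounded1 f -> bounded1 g ->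
  bounded1 (fun x => f x + g x).
Proof.
move=> [mf [K hK]] [mg [K' hK']]; split; first exact: measurable_funD.
by exists (K + K') => x; rewrite (le_trans (ler_normD _ _)) // lerD.
Qed.

Lemma bounded1M (f g : R -> R) : bounded1 f -> bounded1 g ->
  bounded1 (fun x => f x * g x).
Proof.
move=> [mf [K hK]] [mg [K' hK']]; split; first exact: measurable_funM.
by exists (K * K') => x; rewrite normrM ler_pM.
Qed.

Lemma bounded1_cst (c : R) : bounded1 (fun=> c).
Proof. by split; [exact: measurable_cst|exists `|c|]. Qed.

Lemma bounded1_cos (f : R -> R) : measurable_fun setT f ->
  bounded1 (fun x => cos (f x)).
Proof.
move=> mf; split; last first.
  by exists 1 => x; rewrite ler_norml cos_geN1 cos_le1.
apply: (measurableT_comp _ mf).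
by apply: continuous_measurable_fun; exact: continuous_cos.
Qed.

Lemma bounded1_sin (f : R -> R) : measurable_fun setT f ->
  bounded1 (fun x => sin (f x)).
Proof.
move=> mf; split; last first.
  by exists 1 => x; rewrite ler_norml sin_geN1 sin_le1.
apply: (measurableT_comp _ mf).
by apply: continuous_measurable_fun; exact: continuous_sin.
Qed.

Definition bounded_C1 (f : R -> R) := bounded1 f /\
  exists2 f', bounded1 f' & forall x : R, is_derive x 1 f (f' x).

Lemma bounded_C1D (f g : R -> R) : bounded_C1 f -> bounded_C1 g ->
  bounded_C1 (fun x => f x + g x).
Proof.
move=> [bf [f' bf' hf]] [bg [g' bg' hg]]; split; first exact: bounded1D.
exists (fun x => f' x + g' x); first exact: bounded1D.
by move=> x; exact: is_deriveD.
Qed.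

Lemma bounded_C1M (f g : R -> R) : bounded_C1 f -> bounded_C1 g ->
  bounded_C1 (fun x => f x * g x).
Proof.
move=> [bf [f' bf' hf]] [bg [g' bg' hg]]; split; first exact: bounded1M.
exists (fun x => f x * g' x + g x * f' x).
  by apply: bounded1D; exact: bounded1M.
by move=> x; exact: is_deriveM.
Qed.

Lemma bounded_C1N (f : R -> R) : bounded_C1 f -> bounded_C1 (fun x => - f x).
Proof.
move=> h; have -> : (fun x => - f x) = (fun x => -1 * f x).
  by apply/funext => x; rewrite mulN1r.
apply: bounded_C1M => //; split; first exact: bounded1_cst.
by exists (fun=> 0) => [|x]; [exact: bounded1_cst|exact: is_derive_cst].
Qed.

Lemma is_derive_csin (c x : R) :
  is_derive x 1 (fun x => c * sin x) (c * cos x).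
Proof.
have := @is_deriveM _ _ (cst c) sin x 1 0 (cos x) (is_derive_cst _ _ _)
  (is_derive_sin x).
by rewrite scaler0 addr0.
Qed.

Lemma bounded_C1_cos (c : R) : bounded_C1 (fun x => cos (c * sin x)).
Proof.
have mc : measurable_fun setT (fun x => c * sin x).
  by apply: derive_measurable => x; exact: is_derive_csin.
split; first exact: bounded1_cos.
exists (fun x => - 1 * sin (c * sin x) * (c * cos x)).
  apply: bounded1M.
    by apply: bounded1M; [exact: bounded1_cst|exact: bounded1_sin].
  apply: bounded1M; first exact: bounded1_cst.
  by apply: bounded1_cos; exact: measurable_id.
move=> x; rewrite mulN1r.
exact: (is_derive1_comp (is_derive_cos _) (is_derive_csin _ _)).
Qed.

Lemma bounded_C1_sin (c : R) : bounded_C1 (fun x => sin (c * sin x)).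
Proof.
have mc : measurable_fun setT (fun x => c * sin x).
  by apply: derive_measurable => x; exact: is_derive_csin.
split; first exact: bounded1_sin.
exists (fun x => cos (c * sin x) * (c * cos x)).
  apply: bounded1M; first exact: bounded1_cos.
  apply: bounded1M; first exact: bounded1_cst.
  by apply: bounded1_cos; exact: measurable_id.
move=> x; exact: (is_derive1_comp (is_derive_sin _) (is_derive_csin _ _)).
Qed.

Context (n : nat).
Local Notation param := 'rV[R]_n.
Local Notation "f @row" := (fun t : n.-tuple (measurableTypeR R) =>
  f (\row_j tnth t j)) (at level 10).

Record pmeas (f : param -> R) : Prop :=
  Pmeas { pmeasP : measurable_fun setT (f @row) }.

Lemma pmeas_coord (f : R -> R) (k : 'I_n) : measurable_fun setT f ->
  pmeas (fun t => f (t 0 k)).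
Proof.
move=> mf; split; under eq_fun do rewrite mxE.
exact: (measurableT_comp mf (measurable_tnth k)).
Qed.

Lemma pmeasD (f g : param -> R) : pmeas f -> pmeas g ->
  pmeas (fun t => f t + g t).
Proof. by move=> [mf] [mg]; split; exact: measurable_funD. Qed.

Lemma pmeasM (f g : param -> R) : pmeas f -> pmeas g ->
  pmeas (fun t => f t * g t).
Proof. by move=> [mf] [mg]; split; exact: measurable_funM. Qed.

Lemma pmeas_cst (c : R) : pmeas (fun=> c).
Proof. by split; exact: measurable_cst. Qed.

Lemma pmeasN (f : param -> R) : pmeas f -> pmeas (fun t => - f t).
Proof.
move=> h; have -> : (fun t => - f t) = (fun t => -1 * f t).
  by apply/funext => x; rewrite mulN1r.
by apply: pmeasM => //; exact: pmeas_cst.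
Qed.

Lemma pmeas_sum (I : Type) (r : seq I) (F : I -> param -> R) :
  (forall i, pmeas (F i)) -> pmeas (fun t => \sum_(i <- r) F i t).
Proof.
move=> h; elim: r => [|i r IH].
  by under eq_fun do rewrite big_nil; exact: pmeas_cst.
by under eq_fun do rewrite big_cons; exact: (pmeasD (h i) IH).
Qed.

Definition sqnorm (t : param) : R := 1 + \sum_j t 0 j ^+ 2.

Lemma sqnorm_ge1 (t : param) : 1 <= sqnorm t.
Proof. by rewrite lerDl sumr_ge0 // => j _; exact: sqr_ge0. Qed.

Lemma coord_sqnorm (t : param) (k : 'I_n) : t 0 k ^+ 2 <= sqnorm t.
Proof.
rewrite /sqnorm (bigD1 k) //= addrCA lerDl addr_ge0 ?sumr_ge0 // => j _.
exact: sqr_ge0.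
Qed.

Definition lin_growth (f : param -> R) :=
  pmeas f /\ exists2 K, 0 <= K & forall t, f t ^+ 2 <= K * sqnorm t.

Lemma lin_growthD (f g : param -> R) : lin_growth f -> lin_growth g ->
  lin_growth (fun t => f t + g t).
Proof.
move=> [mf [K K0 hK]] [mg [K' K'0 hK']]; split; first exact: pmeasD.
exists (2 * K + 2 * K') => [|t]; first by lra.
have := hK t; have := hK' t; have := sqr_ge0 (f t - g t).
rewrite !expr2; lra.
Qed.

Lemma lin_growthZ (c : R) (f : param -> R) : lin_growth f ->
  lin_growth (fun t => c * f t).
Proof.
move=> [mf [K K0 hK]]; split; first by apply: pmeasM => //; exact: pmeas_cst.
exists (c ^+ 2 * K) => [|t]; first by rewrite mulr_ge0 ?sqr_ge0.
by rewrite exprMn -(mulrA (c ^+ 2)) ler_wpM2l ?sqr_ge0.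
Qed.

Lemma lin_growthN (f : param -> R) : lin_growth f ->
  lin_growth (fun t => - f t).
Proof.
move=> h; have -> : (fun t => - f t) = (fun t => -1 * f t).
  by apply/funext => x; rewrite mulN1r.
exact: lin_growthZ.
Qed.

Lemma lin_growth_sum (I : Type) (r : seq I) (F : I -> param -> R) :
  (forall i, lin_growth (F i)) -> lin_growth (fun t => \sum_(i <- r) F i t).
Proof.
move=> h; elim: r => [|i r IH].
  under eq_fun do rewrite big_nil.
  split; first exact: pmeas_cst.
  by exists 0 => // t; rewrite mul0r expr0n.
by under eq_fun do rewrite big_cons; exact: (lin_growthD (h i) IH).
Qed.

Lemma lin_growth_bounded (f : R -> R) (k : 'I_n) : bounded1 f ->
  lin_growth (fun t => f (t 0 k)).
Proof.
move=> [mf [K hK]]; split; first exact: pmeas_coord.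
exists (K ^+ 2) => [|t]; first exact: sqr_ge0.
apply: (@le_trans _ _ (K ^+ 2)); last by rewrite ler_peMr ?sqr_ge0 ?sqnorm_ge1.
by rewrite -real_normK ?num_real // ler_sqr ?nnegrE // (le_trans _ (hK 0)).
Qed.

Lemma lin_growth_coordM (f : R -> R) (k l : 'I_n) : bounded1 f ->
  lin_growth (fun t => t 0 k * f (t 0 l)).
Proof.
move=> [mf [K hK]]; split.
  by apply: pmeasM; [exact: (@pmeas_coord id)|exact: pmeas_coord].
exists (K ^+ 2) => [|t]; first exact: sqr_ge0.
rewrite exprMn mulrC ler_pM ?sqr_ge0 ?coord_sqnorm //.
by rewrite -real_normK ?num_real // ler_sqr ?nnegrE // (le_trans _ (hK 0)).
Qed.

Definition dlin_growth (f : param -> R) := forall i : 'I_n,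
  exists2 f', lin_growth f' &
    forall t : param, is_derive t ('e_i : param) f (f' t).

Lemma dlin_growthD (f g : param -> R) : dlin_growth f -> dlin_growth g ->
  dlin_growth (fun t => f t + g t).
Proof.
move=> hf hg i; have [f' lf df] := hf i; have [g' lg dg] := hg i.
exists (fun t => f' t + g' t); first exact: lin_growthD.
by move=> t; exact: is_deriveD.
Qed.

Lemma dlin_growthN (f : param -> R) : dlin_growth f ->
  dlin_growth (fun t => - f t).
Proof.
move=> hf i; have [f' lf df] := hf i.
exists (fun t => - f' t); first exact: lin_growthN.
by move=> t; exact: is_deriveN.
Qed.

Lemma dlin_growth_sum (I : Type) (r : seq I) (F : I -> param -> R) :
  (forall i, dlin_growth (F i)) -> dlin_growth (fun t => \sum_(i <- r) F i t).
Proof.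
move=> h; elim: r => [|i r IH].
  under eq_fun do rewrite big_nil.
  move=> i; exists (fun=> 0); last by move=> t; exact: is_derive_cst.
  split; first exact: pmeas_cst.
  by exists 0 => // t; rewrite mul0r expr0n.
by under eq_fun do rewrite big_cons; exact: (dlin_growthD (h i) IH).
Qed.

Lemma is_derive_line (f : param -> R) (t v : param) (d : R) :
  is_derive (0 : R) 1 (fun h : R => f (h *: v + t)) d -> is_derive t v f d.
Proof.
move=> hd; apply: DeriveDef; first by apply/derivable1P; exact: ex_derive.
pose F (h : R) := f (h *: v + t).
have e : (fun h : R => h^-1 *: ((f \o shift t) (h *: v) - f t)) =
    (fun h : R => h^-1 *: ((F \o shift 0) (h *: 1) - F 0)).
  by apply/funext => h /=; rewrite /F addr0 scale0r add0r [_%:A]mulr1.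
by rewrite /derive e; exact: (@derive_val _ _ _ _ _ _ _ hd).
Qed.

Lemma is_derive_affine (a b x : R) : is_derive x 1 (fun h => h * a + b) a.
Proof.
have h1 := @is_deriveM _ _ id (cst a) x 1 1 0 (is_derive_id _ _)
  (is_derive_cst _ _ _).
have := is_deriveD h1 (is_derive_cst b x 1).
by rewrite scaler0 add0r addr0 [_%:A]mulr1.
Qed.

Lemma dlin_growth_coordM (f : R -> R) (k l : 'I_n) : bounded_C1 f ->
  dlin_growth (fun t => t 0 k * f (t 0 l)).
Proof.
move=> [bf [f' bf' df]] i.
pose e := 'e_i : param.
exists (fun t => t 0 k * f' (t 0 l) * e 0 l + f (t 0 l) * e 0 k).
  apply: lin_growthD.
    under eq_fun do rewrite mulrC.
    by apply: lin_growthZ; exact: lin_growth_coordM.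
  under eq_fun do rewrite mulrC.
  by apply: lin_growthZ; exact: lin_growth_bounded.
move=> t; apply: is_derive_line.
have -> : (fun h : R => (h *: 'e_i + t) 0 k * f ((h *: 'e_i + t) 0 l)) =
    (fun h => h * e 0 k + t 0 k) * (f \o (fun h => h * e 0 l + t 0 l)).
  by apply/funext => h /=; rewrite !mxE.
have h1 : is_derive (0 : R) 1 (f \o (fun h => h * e 0 l + t 0 l))
    (f' (t 0 l) * e 0 l).
  apply: is_derive1_comp; last exact: is_derive_affine.
  by rewrite mul0r add0r.
have := is_deriveM (is_derive_affine (e 0 k) (t 0 k) 0) h1.
by rewrite /= !mul0r !add0r !/(_ *: _) /= mulrA.
Qed.

End Growth.

Section Weighted_mean.
Context {R : realType} (n : nat).
Local Notation param := 'rV[R]_n.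
Local Notation C := R[i].
Context (mu : probability (n.-tuple (measurableTypeR R)) R).
Context (w : param -> R) (Z : R).
Hypothesis mu2 : forall j : 'I_n, (\int[mu]_t (tnth t j ^+ 2)%:E < +oo)%E.
Hypothesis mw : pmeas w.
Hypothesis w0 : forall t, 0 <= w t.
Hypothesis wB : exists K, forall t, w t <= K.
Hypothesis Z0 : 0 <= Z.

Definition wmean (g : param -> R) : R :=
  (\int[mu]_t (g (\row_j tnth t j) * w (\row_j tnth t j)))%R / Z.

Definition wmean_mx p q (g : param -> 'M[C]_(p, q)) : 'M[C]_(p, q) :=
  \matrix_(a, b) (wmean (fun t => complex.Re (g t a b))
                  +i* wmean (fun t => complex.Im (g t a b))).

Definition wint (g : param -> R) :=
  mu.-integrable setT
    (EFin \o (fun t => g (\row_j tnth t j) * w (\row_j tnth t j))).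

Lemma eq_wmean g h : g =1 h -> wmean g = wmean h.
Proof. by move=> e; congr wmean; apply/funext. Qed.

Lemma wintD g h : wint g -> wint h -> wint (fun t => g t + h t).
Proof.
move=> ig ih; rewrite /wint.
under eq_fun do rewrite /= mulrDl.
exact: (integrableD _ ig ih).
Qed.

Lemma wintZ c g : wint g -> wint (fun t => c * g t).
Proof.
move=> ig; rewrite /wint.
under eq_fun do rewrite /= -mulrA.
exact: (integrableZl _ c ig).
Qed.

Lemma wintN g : wint g -> wint (fun t => - g t).
Proof.
by move=> /(wintZ (-1)); under eq_fun do rewrite mulN1r.
Qed.

Lemma wint0 : wint (fun=> 0).
Proof.
rewrite /wint; under eq_fun do rewrite /= mul0r.
exact: integrable0.
Qed.

Lemma wint_sum (I : Type) (r : seq I) (F : I -> param -> R) :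
  (forall i, wint (F i)) -> wint (fun t => \sum_(i <- r) F i t).
Proof.
move=> h; elim: r => [|i r IH].
  by under eq_fun do rewrite big_nil; exact: wint0.
by under eq_fun do rewrite big_cons; exact: (wintD (h i) IH).
Qed.

Lemma wmeanD g h : wint g -> wint h ->
  wmean (fun t => g t + h t) = wmean g + wmean h.
Proof.
move=> ig ih; rewrite /wmean -mulrDl; congr (_ / Z).
by under eq_Rintegral do rewrite mulrDl; rewrite RintegralD.
Qed.

Lemma wmeanZ c g : wint g -> wmean (fun t => c * g t) = c * wmean g.
Proof.
move=> ig; rewrite /wmean mulrA; congr (_ / Z).
by under eq_Rintegral do rewrite -mulrA; rewrite RintegralZl.
Qed.

Lemma wmeanN g : wint g -> wmean (fun t => - g t) = - wmean g.
Proof.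
move=> ig; have := wmeanZ (-1) ig; rewrite mulN1r => <-.
by congr wmean; apply/funext => t; rewrite mulN1r.
Qed.

Lemma wmean_sum (I : Type) (r : seq I) (F : I -> param -> R) :
  (forall i, wint (F i)) ->
  wmean (fun t => \sum_(i <- r) F i t) = \sum_(i <- r) wmean (F i).
Proof.
move=> h; elim: r => [|i r IH].
  rewrite big_nil; under eq_fun do rewrite big_nil.
  rewrite -[RHS](mul0r (wmean (fun=> 0))) -(wmeanZ 0 wint0).
  by congr wmean; apply/funext => t; rewrite mul0r.
rewrite big_cons -IH -wmeanD //; last exact: wint_sum.
by congr wmean; apply/funext => t; rewrite big_cons.
Qed.

Lemma wmean_ge0 g : (forall t, 0 <= g t) -> 0 <= wmean g.
Proof.
move=> g0; rewrite /wmean divr_ge0 //.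
by apply: Rintegral_ge0 => t _; rewrite mulr_ge0.
Qed.

Let integrable_sqnorm :
  mu.-integrable setT (EFin \o (fun t => sqnorm (\row_j tnth t j))).
Proof.
have e : EFin \o (fun t : n.-tuple (measurableTypeR R) =>
      sqnorm (\row_j tnth t j)) =
    (fun t => (cst 1 t)%:E + \sum_(j <- index_enum 'I_n) (tnth t j ^+ 2)%:E)%E.
  apply/funext => t; rewrite /= /sqnorm EFinD -sumEFin; congr (_ + _)%E.
  by apply: eq_bigr => j _; rewrite mxE.
rewrite e; apply: integrableD => //.
  exact: finite_measure_integrable_cst.
apply: integrable_sum => // j _; apply/integrableP; split.
  apply/measurable_EFinP; apply: measurable_funX.
  exact: (@measurable_tnth _ _ n j).
by under eq_integral do rewrite gee0_abs ?lee_fin ?sqr_ge0 //.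
Qed.

Lemma wint_mul (f g : param -> R) : lin_growth f -> lin_growth g ->
  wint (fun t => f t * g t).
Proof.
move=> [mf [K K0 hK]] [mg [K' K'0 hK']].
have [B hB] := wB.
have B0 : 0 <= B by apply: le_trans (hB 0).
apply: (@le_integrable _ _ _ mu setT measurableT _
  (fun t => (B * (K + K'))%:E *
     (EFin \o (fun t => sqnorm (\row_j tnth t j))) t)%E).
- by apply/measurable_EFinP; exact: (pmeasP (pmeasM (pmeasM mf mg) mw)).
- move=> t _; rewrite /= lee_fin; set x := \row_j tnth t j.
  rewrite normrM (ger0_norm (w0 x)).
  have s0 : 0 <= sqnorm x by rewrite (le_trans _ (sqnorm_ge1 x)).
  rewrite [leRHS]ger0_norm; last by rewrite !mulr_ge0 // addr_ge0.
  rewrite mulrC -(mulrA B) ler_pM // ?normr_ge0 //.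
  have h1 := hK x; have h2 := hK' x.
  rewrite mulrDl ler_norml.
  have := sqr_ge0 (f x - g x); have := sqr_ge0 (f x + g x).
  rewrite sqrrB sqrrD; have := sqr_ge0 (f x); have := sqr_ge0 (g x).
  move: h1 h2; lra.
- exact: (integrableZl _ _ integrable_sqnorm).
Qed.

Definition mx_lin_growth p q (g : param -> 'M[C]_(p, q)) := forall a b,
  lin_growth (fun t => complex.Re (g t a b)) /\
  lin_growth (fun t => complex.Im (g t a b)).

Definition mx_wint p q (g : param -> 'M[C]_(p, q)) := forall a b,
  wint (fun t => complex.Re (g t a b)) /\
  wint (fun t => complex.Im (g t a b)).

Lemma mx_lin_growth_mull p q r (A : 'M[C]_(p, q)) (g : param -> 'M[C]_(q, r)) :
  mx_lin_growth g -> mx_lin_growth (fun t => A *m g t).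
Proof.
move=> h a b; split.
  under eq_fun do rewrite mxE cRe_sum.
  apply: lin_growth_sum => j; under eq_fun do rewrite cReM.
  apply: lin_growthD; first by apply: lin_growthZ; case: (h j b).
  by apply: lin_growthN; apply: lin_growthZ; case: (h j b).
under eq_fun do rewrite mxE cIm_sum.
apply: lin_growth_sum => j; under eq_fun do rewrite cImM.
by apply: lin_growthD; apply: lin_growthZ; case: (h j b).
Qed.

Lemma mx_lin_growth_ctr p q (g : param -> 'M[C]_(p, q)) :
  mx_lin_growth g -> mx_lin_growth (fun t => (g t)^t*).
Proof.
move=> h a b; have [h1 h2] := h b a; split.
  by under eq_fun do rewrite !mxE cRe_conj.
by under eq_fun do rewrite !mxE cIm_conj; exact: lin_growthN.
Qed.

Lemma mx_lin_growth_mulr p q r (g : param -> 'M[C]_(p, q)) (A : 'M[C]_(q, r)) :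
  mx_lin_growth g -> mx_lin_growth (fun t => g t *m A).
Proof.
move=> /mx_lin_growth_ctr /(mx_lin_growth_mull (A^t*)) /mx_lin_growth_ctr.
by under eq_fun do rewrite ctr_mul !ctrK.
Qed.

Lemma mx_wint_mul p q r (g : param -> 'M[C]_(p, q))
    (h : param -> 'M[C]_(q, r)) :
  mx_lin_growth g -> mx_lin_growth h -> mx_wint (fun t => g t *m h t).
Proof.
move=> lg lh a b; split.
  under eq_fun do rewrite mxE cRe_sum.
  apply: wint_sum => j; under eq_fun do rewrite cReM.
  have [g1 g2] := lg a j; have [h1 h2] := lh j b.
  by apply: wintD; [|apply: wintN]; exact: wint_mul.
under eq_fun do rewrite mxE cIm_sum.
apply: wint_sum => j; under eq_fun do rewrite cImM.
have [g1 g2] := lg a j; have [h1 h2] := lh j b.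
by apply: wintD; exact: wint_mul.
Qed.

Lemma wint_retr p q (B : 'M[C]_(q, p)) (g : param -> 'M[C]_(p, q)) :
  mx_wint g -> wint (fun t => retr (B *m g t)).
Proof.
move=> ig; rewrite /retr /mxtrace; under eq_fun do rewrite cRe_sum.
apply: wint_sum => i; under eq_fun do rewrite mxE cRe_sum.
apply: wint_sum => j; under eq_fun do rewrite cReM.
have [h1 h2] := ig j i.
by apply: wintD; [|apply: wintN]; exact: wintZ.
Qed.

Lemma retr_wmean_mx p q (B : 'M[C]_(q, p)) (g : param -> 'M[C]_(p, q)) :
  mx_wint g -> retr (B *m wmean_mx g) = wmean (fun t => retr (B *m g t)).
Proof.
move=> ig; rewrite /retr /mxtrace cRe_sum.
under [X in wmean X]eq_fun do rewrite cRe_sum.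
have i1 i j : wint (fun t => complex.Re (B i j * g t j i)).
  have [h1 h2] := ig j i; under eq_fun do rewrite cReM.
  by apply: wintD; [|apply: wintN]; exact: wintZ.
rewrite wmean_sum; last first.
  by move=> i; under eq_fun do rewrite mxE cRe_sum; exact: wint_sum.
apply: eq_bigr => i _; rewrite mxE cRe_sum.
under [X in wmean X]eq_fun do rewrite mxE cRe_sum.
rewrite wmean_sum //; apply: eq_bigr => j _.
under [X in wmean X]eq_fun do rewrite cReM.
have [h1 h2] := ig j i.
rewrite wmeanD; [|exact: wintZ|by apply: wintN; exact: wintZ].
by rewrite wmeanN; [rewrite !wmeanZ // cReM !mxE|exact: wintZ].
Qed.

Lemma wmean_mx_lin p q (c : R) (g h : param -> 'M[C]_(p, q)) :
  mx_wint g -> mx_wint h ->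
  wmean_mx (fun t => c%:C *: g t + h t) = c%:C *: wmean_mx g + wmean_mx h.
Proof.
move=> ig ih; apply/matrixP => a b; rewrite !mxE.
have [g1 g2] := ig a b; have [h1 h2] := ih a b.
under [X in wmean X +i* _]eq_fun do rewrite !mxE cReD cRe_realM.
under [X in _ +i* wmean X]eq_fun do rewrite !mxE cImD cIm_realM.
rewrite !wmeanD ?wmeanZ //; try exact: wintZ.
by apply/eqP; rewrite eq_complex /= !mul0r subr0 addr0 !eqxx.
Qed.

Lemma wmean_mx_ctr p q (g : param -> 'M[C]_(p, q)) : mx_wint g ->
  (wmean_mx g)^t* = wmean_mx (fun t => (g t)^t*).
Proof.
move=> ig; apply/matrixP => a b; rewrite !mxE.
have [g1 g2] := ig b a.
under [X in _ = wmean X +i* _]eq_fun do rewrite !mxE cRe_conj.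
under [X in _ = _ +i* wmean X]eq_fun do rewrite !mxE cIm_conj.
by rewrite wmeanN.
Qed.

Lemma psdC_retr p (A : 'M[C]_p) : A \is hermsymmx ->
  (forall x : 'cV[C]_p, 0 <= retr (x *m x^t* *m A)) -> psdC A.
Proof.
move=> hA h; split=> // x; set z := _ 0 0.
have e : (x^t* *m A *m x)^t* = x^t* *m A *m x.
  by rewrite !ctr_mul ctrK (hermP _ hA) mulmxA.
have /matrixP /(_ 0 0) := e; rewrite mxE mxE -/z => ez.
have zr : z \is Num.real by apply/CrealP.
rewrite -(RRe_real zr) ler0c.
by have := h x; rewrite -mulmxA retrC /retr /mxtrace big_ord1.
Qed.

Lemma wmean_mx_psd p q (g : param -> 'M[C]_(p, q)) : mx_lin_growth g ->
  psdC (wmean_mx (fun t => g t *m (g t)^t*)).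
Proof.
move=> lg; have ig := mx_wint_mul lg (mx_lin_growth_ctr lg).
apply: psdC_retr.
  apply/hermP; rewrite wmean_mx_ctr //; congr wmean_mx; apply/funext => t.
  by rewrite ctr_mul ctrK.
move=> x; rewrite retr_wmean_mx //; apply: wmean_ge0 => t.
have -> : retr (x *m x^t* *m (g t *m (g t)^t*)) =
    retr (((g t)^t* *m x)^t* *m ((g t)^t* *m x)).
  by rewrite ctr_mul ctrK -!mulmxA retrC -!mulmxA.
exact: retr_normal_ge0.
Qed.

End Weighted_mean.

(** * The posterior Fisher information *)

Section Measurable_matrices.
Context {R : realType} (n : nat).
Local Notation param := 'rV[R]_n.
Local Notation C := R[i].

Definition mx_pmeas p q (g : param -> 'M[C]_(p, q)) := forall a b,
  pmeas (fun t => complex.Re (g t a b)) /\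
  pmeas (fun t => complex.Im (g t a b)).

Lemma mx_pmeas_cst p q (A : 'M[C]_(p, q)) : mx_pmeas (fun=> A).
Proof. by move=> a b; split; exact: pmeas_cst. Qed.

Lemma mx_pmeasB p q (g h : param -> 'M[C]_(p, q)) :
  mx_pmeas g -> mx_pmeas h -> mx_pmeas (fun t => g t - h t).
Proof.
move=> mg mh a b; have [g1 g2] := mg a b; have [h1 h2] := mh a b; split.
  under eq_fun do rewrite !mxE cReD cReN.
  by apply: pmeasD => //; exact: pmeasN.
under eq_fun do rewrite !mxE cImD cImN.
by apply: pmeasD => //; exact: pmeasN.
Qed.

Lemma mx_pmeas_ctr p q (g : param -> 'M[C]_(p, q)) :
  mx_pmeas g -> mx_pmeas (fun t => (g t)^t*).
Proof.
move=> mg a b; have [h1 h2] := mg b a; split.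
  by under eq_fun do rewrite !mxE cRe_conj.
by under eq_fun do rewrite !mxE cIm_conj; exact: pmeasN.
Qed.

Lemma mx_pmeasM p q r (g : param -> 'M[C]_(p, q)) (h : param -> 'M[C]_(q, r)) :
  mx_pmeas g -> mx_pmeas h -> mx_pmeas (fun t => g t *m h t).
Proof.
move=> mg mh a b; split.
  under eq_fun do rewrite mxE cRe_sum.
  apply: pmeas_sum => j; under eq_fun do rewrite cReM.
  have [g1 g2] := mg a j; have [h1 h2] := mh j b.
  by apply: pmeasD; [|apply: pmeasN]; exact: pmeasM.
under eq_fun do rewrite mxE cIm_sum.
apply: pmeas_sum => j; under eq_fun do rewrite cImM.
have [g1 g2] := mg a j; have [h1 h2] := mh j b.
by apply: pmeasD; exact: pmeasM.
Qed.

Lemma pmeas_retr p (g : param -> 'M[C]_p) :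
  mx_pmeas g -> pmeas (fun t => retr (g t)).
Proof.
move=> mg; rewrite /retr /mxtrace; under eq_fun do rewrite cRe_sum.
by apply: pmeas_sum => j; case: (mg j j).
Qed.

End Measurable_matrices.

Section Response.
Context {R : realType} (L NT NR : nat).
Local Notation C := R[i].
Local Notation param := 'rV[R]_(dim3 L).
Local Notation iphi i := (lshift (L + L) i).
Local Notation ire i := (rshift L (lshift L i)).
Local Notation iim i := (rshift L (rshift L i)).

Let arg (a : nat) (x : R) : R := a%:R * pi * sin x.
Let fA (a b : nat) (x : R) : R :=
  cos (arg a x) * cos (arg b x) + sin (arg a x) * sin (arg b x).
Let fB (a b : nat) (x : R) : R :=
  sin (arg a x) * cos (arg b x) + - (cos (arg a x) * sin (arg b x)).

Let C1A a b : bounded_C1 (fA a b).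
Proof.
by apply: bounded_C1D; apply: bounded_C1M;
  [exact: bounded_C1_cos|exact: bounded_C1_cos
  |exact: bounded_C1_sin|exact: bounded_C1_sin].
Qed.

Let C1B a b : bounded_C1 (fB a b).
Proof.
apply: bounded_C1D; [|apply: bounded_C1N]; apply: bounded_C1M;
  by [exact: bounded_C1_cos|exact: bounded_C1_sin].
Qed.

Lemma Re_responseE (t : param) (a : 'I_NR) (b : 'I_NT) :
  complex.Re (response NT NR t a b) = \sum_(i < L)
    (t 0 (ire i) * fA a b (t 0 (iphi i)) +
     - (t 0 (iim i) * fB a b (t 0 (iphi i)))).
Proof.
rewrite /response summxE cRe_sum; apply: eq_bigr => i _.
rewrite !mxE big_ord1 !mxE cReM cReM cImM cRe_conj cIm_conj /=.
by rewrite /phi /fA /fB /arg; ring.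
Qed.

Lemma Im_responseE (t : param) (a : 'I_NR) (b : 'I_NT) :
  complex.Im (response NT NR t a b) = \sum_(i < L)
    (t 0 (ire i) * fB a b (t 0 (iphi i)) + t 0 (iim i) * fA a b (t 0 (iphi i))).
Proof.
rewrite /response summxE cIm_sum; apply: eq_bigr => i _.
rewrite !mxE big_ord1 !mxE cImM cReM cImM cRe_conj cIm_conj /=.
by rewrite /phi /fA /fB /arg; ring.
Qed.

Lemma mx_pmeas_response : mx_pmeas (@response R L NT NR).
Proof.
move=> a b; split.
  under eq_fun do rewrite Re_responseE.
  apply: pmeas_sum => i; apply: pmeasD; [|apply: pmeasN].
    by case: (lin_growth_coordM (ire i) (iphi i) (C1A a b).1).
  by case: (lin_growth_coordM (iim i) (iphi i) (C1B a b).1).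
under eq_fun do rewrite Im_responseE.
apply: pmeas_sum => i; apply: pmeasD.
  by case: (lin_growth_coordM (ire i) (iphi i) (C1B a b).1).
by case: (lin_growth_coordM (iim i) (iphi i) (C1A a b).1).
Qed.

Lemma mx_lin_growth_dresponse (i : 'I_(dim3 L)) :
  mx_lin_growth (@dresponse R L NT NR i).
Proof.
have dre a b : dlin_growth (fun t => complex.Re (@response R L NT NR t a b)).
  under eq_fun do rewrite Re_responseE.
  apply: dlin_growth_sum => j; apply: dlin_growthD; [|apply: dlin_growthN];
    exact: dlin_growth_coordM.
have dim a b : dlin_growth (fun t => complex.Im (@response R L NT NR t a b)).
  under eq_fun do rewrite Im_responseE.
  by apply: dlin_growth_sum => j; apply: dlin_growthD;
    exact: dlin_growth_coordM.
move=> a b; split.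
  have [f' lf df] := dre a b i.
  rewrite (_ : (fun t => _) = f') //; apply/funext => t; rewrite mxE /=.
  exact: derive_val.
have [f' lf df] := dim a b i.
rewrite (_ : (fun t => _) = f') //; apply/funext => t; rewrite mxE /=.
exact: derive_val.
Qed.

Lemma mx_lin_growth_Gdot MR (W : 'M[C]_(NR, MR)) (m : 'I_MR) :
  mx_lin_growth (@Gdot R L NT NR MR W m).
Proof.
move=> a i.
have := mx_lin_growth_mulr (col m W)
  (mx_lin_growth_ctr (mx_lin_growth_dresponse i)) a 0.
by move=> [h1 h2]; split; under eq_fun do rewrite mxE.
Qed.

Lemma col_Gdot MR (W : 'M[C]_(NR, MR)) (m : 'I_MR) (t : param) i :
  col i (@Gdot R L NT NR MR W m t) = (dresponse NT NR i t)^t* *m col m W.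
Proof. by apply/colP => a; rewrite mxE mxE. Qed.

End Response.

Section Posterior_mean.
Context {R : realType} (L NT NR MT MR : nat).
Local Notation C := R[i].
Local Notation param := 'rV[R]_(dim3 L).
Context (phimin phimax : R) (hphi : phimin < phimax).
Context (Vpol : seq 'M[C]_(MR, MT) -> 'M[C]_(NT, MT))
        (Wpol : seq 'M[C]_(MR, MT) -> 'M[C]_(NR, MR))
        (Y : seq 'M[C]_(MR, MT)).
Hypothesis hWpol : forall l, (l < size Y)%N ->
  (Wpol (take l Y))^t* *m Wpol (take l Y) \in unitmx.

Lemma stage_pdf_bounded (V : 'M[C]_(NT, MT)) (W : 'M[C]_(NR, MR))
    (y : 'M[C]_(MR, MT)) : W^t* *m W \in unitmx ->
  exists K, forall t : param, 0 <= stage_pdf V W y t <= K.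
Proof.
move=> uS; set S := W^t* *m W in uS.
pose c := pi ^+ (MR * MT) * complex.Re (\det S) ^+ MT : R.
have c0 : 0 <= c.
  rewrite mulr_ge0 ?exprn_ge0 ?pi_ge0 //.
  exact: det_psd_ge0 (psdC_normal W).
exists c^-1 => t; rewrite /stage_pdf -/S -/c.
move: (y - _) => D; have q0 : 0 <= retr (D^t* *m invmx S *m D).
  have := retr_normal_ge0 (W *m invmx S *m D).
  rewrite !ctr_mul !mulmxA -(mulmxA (D^t* *m (invmx S)^t*) (W^t*) W) -/S.
  by rewrite mulmxK // -retr_ctr !ctr_mul !ctrK mulmxA.
rewrite divr_ge0 ?expR_ge0 //= ler_piMl ?invr_ge0 //.
by rewrite -expR0 ler_expR oppr_le0.
Qed.

Lemma pmeas_stage_pdf (V : 'M[C]_(NT, MT)) (W : 'M[C]_(NR, MR))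
    (y : 'M[C]_(MR, MT)) : pmeas (@stage_pdf R L NT NR MT MR V W y).
Proof.
pose D (t : param) := y - W^t* *m response NT NR t *m V.
have mD : mx_pmeas D.
  apply: mx_pmeasB; first exact: mx_pmeas_cst.
  apply: mx_pmeasM; last exact: mx_pmeas_cst.
  by apply: mx_pmeasM; [exact: mx_pmeas_cst|exact: mx_pmeas_response].
have mq : pmeas (fun t => - retr ((D t)^t* *m invmx (W^t* *m W) *m D t)).
  apply: pmeasN; apply: pmeas_retr; apply: mx_pmeasM => //.
  by apply: mx_pmeasM; [exact: mx_pmeas_ctr|exact: mx_pmeas_cst].
apply: pmeasM; last exact: pmeas_cst.
by split; exact: (measurableT_comp (@measurable_expR R) (pmeasP mq)).
Qed.

Lemma pmeas_likelihood : pmeas (@likelihood R L NT NR MT MR Vpol Wpol Y).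
Proof.
rewrite /likelihood; elim: (index_enum _) => [|l s IH].
  by under eq_fun do rewrite big_nil; exact: pmeas_cst.
under eq_fun do rewrite big_cons.
exact: (pmeasM (pmeas_stage_pdf _ _ _) IH).
Qed.

Lemma likelihood_bounded :
  exists K, forall t : param, 0 <= likelihood Vpol Wpol Y t <= K.
Proof.
rewrite /likelihood; elim: (index_enum _) => [|l s [K hK]].
  by exists 1 => t; rewrite big_nil ler01 lexx.
have [K' hK'] := stage_pdf_bounded (Vpol (take l Y)) (nth 0 Y l)
  (hWpol (ltn_ord l)).
exists (K' * K) => t; rewrite big_cons.
by have /andP[a0 aK] := hK' t; have /andP[b0 bK] := hK t;
  rewrite mulr_ge0 //= ler_pM.
Qed.

Let w := @likelihood R L NT NR MT MR Vpol Wpol Y.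
Let Z := evidence L hphi Vpol Wpol Y.
Let mu := prior_law L hphi.

Let w0 t : 0 <= w t.
Proof. by have [K /(_ t) /andP[]] := likelihood_bounded. Qed.

Let wB : exists K, forall t, w t <= K.
Proof.
by have [K hK] := likelihood_bounded; exists K => t; case/andP: (hK t).
Qed.

Let mw : pmeas w. Proof. exact: pmeas_likelihood. Qed.

Let Z0 : 0 <= Z.
Proof. by apply: Rintegral_ge0 => t _; exact: w0. Qed.

Let mu2 (j : 'I_(dim3 L)) : (\int[mu]_t (tnth t j ^+ 2)%:E < +oo)%E.
Proof.
rewrite (@integral_indep_law_tnth R _ _ j (fun x => (x ^+ 2)%:E)).
- rewrite /prior_marginal; case: fintype.split => _.
    exact: uniform_second_moment.
  by apply: normal_second_moment; rewrite gt_eqF // sqrtr_gt0 invr_gt0.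
- by apply/measurable_EFinP; exact: measurable_funX.
- by move=> x; rewrite lee_fin sqr_ge0.
Qed.

Local Notation E := (wmean_mx mu w Z).
Local Notation D i t := (dresponse NT NR i t).
Local Notation JD := (JD L hphi Vpol Wpol Y).

Let wintDD (A : 'M[C]_NR) (B : 'M[C]_NT) (i j : 'I_(dim3 L)) :
  mx_wint mu w (fun t => A *m D i t *m B *m (D j t)^t*).
Proof.
apply: mx_wint_mul => //.
  by apply/mx_lin_growth_mulr/mx_lin_growth_mull/mx_lin_growth_dresponse.
exact/mx_lin_growth_ctr/mx_lin_growth_dresponse.
Qed.

Let JDE A B i j : JD B A i j =
  2 * wmean mu w Z (fun t => retr (A *m D i t *m B *m (D j t)^t*)).
Proof.
rewrite mxE; congr (2 * _).
have h := retr_wmean_mx Z 1%:M (wintDD A B i j); rewrite mul1mx in h.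
apply: (etrans h); congr (wmean _ _ _); apply/funext => t.
by rewrite mul1mx.
Qed.

Lemma JD_sym (A : 'M[C]_NR) (B : 'M[C]_NT) : A \is hermsymmx ->
  B \is hermsymmx -> (JD B A)^T = JD B A.
Proof.
move=> hA hB; apply/matrixP => i j; rewrite mxE !JDE.
have e t := retr_sandwich_sym (D j t) (D i t) hA hB.
refine (congr1 (fun x : R => 2 * x) (eq_wmean mu w Z _)) => t; exact: e.
Qed.

Context (U : 'M[C]_(NR, MR)).
Local Notation PT := (Ptilde hphi Vpol Wpol Y U).
Local Notation G m t := (Gdot NT U m t).

Let wintG (X : 'M[R]_(dim3 L)) m :
  mx_wint mu w (fun t => G m t *m toC X *m (G m t)^t*).
Proof.
apply: mx_wint_mul => //.
  exact/mx_lin_growth_mulr/mx_lin_growth_Gdot.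
exact/mx_lin_growth_ctr/mx_lin_growth_Gdot.
Qed.

Lemma Ptilde_lin (a : R) (X X' : 'M[R]_(dim3 L)) :
  PT (a *: X + X') = a%:C *: PT X + PT X'.
Proof.
rewrite /Ptilde scaler_sumr -big_split; apply: eq_bigr => m _.
rewrite -[RHS](wmean_mx_lin Z a (wintG X m) (wintG X' m)).
congr (wmean_mx _ _ _ _); apply/funext => t.
rewrite /toC map_mxD map_mxZ /= mulmxDr mulmxDl.
by rewrite -scalemxAr -scalemxAl.
Qed.

Lemma ctr_toC p q (X : 'M[R]_(p, q)) : (toC X)^t* = toC X^T.
Proof. by apply/matrixP => i j; rewrite !mxE /= conj_real. Qed.

Lemma Ptilde_herm (X : 'M[R]_(dim3 L)) : X^T = X -> PT X \is hermsymmx.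
Proof.
move=> hX; rewrite /Ptilde; apply: (big_ind (fun A => A \is hermsymmx)).
- by case: (@psdC0 R NT).
- move=> A B /hermP hA /hermP hB; apply/hermP; by rewrite ctrD hA hB.
- move=> m _; apply/hermP; rewrite (wmean_mx_ctr _ (wintG X m)).
  congr wmean_mx; apply/funext => t.
  by rewrite !ctr_mul ctrK ctr_toC hX mulmxA.
Qed.

Lemma Ptilde_psd (A : 'M[R]_(dim3 L)) : psdC (PT (A *m A^T)).
Proof.
rewrite /Ptilde; apply: (big_ind (@psdC R NT)).
- exact: psdC0.
- exact: psdCD.
- move=> m _.
  have h : mx_lin_growth (fun t => G m t *m toC A).
    exact/mx_lin_growth_mulr/mx_lin_growth_Gdot.
  have := wmean_mx_psd mu2 mw w0 wB Z0 h.
  congr (psdC (wmean_mx _ _ _ _)); apply/funext => t.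
  by rewrite ctr_mul ctr_toC /toC map_mxM !mulmxA.
Qed.

Lemma trace_JD_Ptilde (X : 'M[R]_(dim3 L)) (B : 'M[C]_NT) :
  \tr (X *m JD B (U *m U^t*)) = 2 * retr (B *m PT X).
Proof.
set A := U *m U^t*.
have pt (t : param) : \sum_i \sum_j X i j *
      retr (A *m D j t *m B *m (D i t)^t*) =
    \sum_m retr (B *m (G m t *m toC X *m (G m t)^t*)).
  have e m : retr (B *m (G m t *m toC X *m (G m t)^t*)) =
      \sum_i \sum_j X i j * complex.Re
        (((col m U)^t* *m (D j t *m B *m (D i t)^t*) *m col m U) 0 0).
    rewrite !mulmxA retrC !mulmxA retrC /retr /mxtrace cRe_sum.
    apply: eq_bigr => i _; rewrite mxE cRe_sum; apply: eq_bigr => j _.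
    rewrite mxE cRe_realM; congr (_ * complex.Re _).
    rewrite mulmx_row_col col_Gdot row_mul.
    have -> : row j ((G m t)^t*) = (col m U)^t* *m D j t.
      have -> : row j ((G m t)^t*) = (col j (G m t))^t*.
        by apply/rowP => a; rewrite !mxE.
      by rewrite col_Gdot ctr_mul ctrK.
    by rewrite !mulmxA.
  under [RHS]eq_bigr do rewrite e.
  rewrite [RHS]exchange_big; apply: eq_bigr => i _.
  rewrite [RHS]exchange_big; apply: eq_bigr => j _ /=.
  rewrite -mulr_sumr; congr (_ * _).
  have -> : A *m D j t *m B *m (D i t)^t* =
      U *m U^t* *m (D j t *m B *m (D i t)^t*) by rewrite /A !mulmxA.
  exact: retr_frame.
have iw i j : wint mu w (fun t => X i j * retr (A *m D j t *m B *m (D i t)^t*)).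
  apply: wintZ; have := wint_retr 1%:M (wintDD A B j i).
  by under eq_fun do rewrite mul1mx.
have -> : \tr (X *m JD B A) = 2 * wmean mu w Z (fun t =>
    \sum_i \sum_j X i j * retr (A *m D j t *m B *m (D i t)^t*)).
  rewrite wmean_sum; last by move=> i; exact: wint_sum.
  rewrite mulr_sumr; apply: eq_bigr => i _.
  rewrite wmean_sum // mulr_sumr mxE; apply: eq_bigr => j _.
  rewrite wmeanZ; last first.
    have := wint_retr 1%:M (wintDD A B j i).
    by under eq_fun do rewrite mul1mx.
  by rewrite JDE mulrCA.
rewrite (eq_wmean mu w Z pt); congr (2 * _).
rewrite wmean_sum; last by move=> m; apply: wint_retr; exact: wintG.
rewrite /Ptilde mulmx_sumr retr_sum; apply: eq_bigr => m _.
exact/esym/(retr_wmean_mx Z B (wintG X m)).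
Qed.

End Posterior_mean.

(* k is the current stage. The columns u_1, ..., u_MR of U, which enter
   [Ptilde], are an orthonormal basis of the column space of W; one may take
   U := W as soon as W has orthonormal columns. *)
Theorem corollary6 (R : realType) (L MT NT MR NR : nat)
  (hL : (1 <= L)%N)
  (hMT : (1 <= MT < NT)%N) (hMR : (1 <= MR < NR)%N)
  (P : R) (hP : 0 < P)
  (q : 'I_(dim3 L) -> R) (hq : forall l, 0 <= q l) (hq1 : \sum_l q l = 1)
  (phimin phimax : R) (hphi : phimin < phimax)
  (k : nat) (hk : (1 <= k)%N)
  (Vpol : seq 'M[R[i]]_(MR, MT) -> 'M[R[i]]_(NT, MT))
  (Wpol : seq 'M[R[i]]_(MR, MT) -> 'M[R[i]]_(NR, MR))
  (Y : (k.-1).-tuple 'M[R[i]]_(MR, MT))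
  (hWpol : forall l, (l < k.-1)%N ->
     (Wpol (take l Y))^t* *m Wpol (take l Y) \in unitmx)
  (hident : identifiable L hphi Vpol Wpol Y)
  (W : 'M[R[i]]_(NR, MR)) (hW : W^t* *m W \in unitmx)
  (U : 'M[R[i]]_(NR, MR))
  (hU : U^t* *m U = 1%:M) (hUW : U *m U^t* = range_proj W)
  (Lam : 'M[R]_(dim3 L))
  (hLam : forall Lam' : 'M[R]_(dim3 L),
     dual_objective hphi Vpol Wpol Y q P U Lam' <=
     dual_objective hphi Vpol Wpol Y q P U Lam)
  (hgap : eig_desc MT.+1 (Ptilde hphi Vpol Wpol Y U (Lam *m Lam^T)) <
          eig_desc MT (Ptilde hphi Vpol Wpol Y U (Lam *m Lam^T))) :
  optimal_value (feasible_SDR hphi Vpol Wpol Y q P (range_proj W)) =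
  optimal_value (feasible_A hphi Vpol Wpol Y q P (range_proj W)).

Proof.
set RW := range_proj W.
have hY : forall l, (l < size Y)%N ->
    (Wpol (take l Y))^t* *m Wpol (take l Y) \in unitmx.
  by move=> l; rewrite size_tuple; exact: hWpol.
have hRW : RW \is hermsymmx.
  by rewrite /RW -hUW; apply/hermP; rewrite ctr_mul ctrK.
have P1 a (X X' : 'M[R]_(dim3 L)) := Ptilde_lin hphi Vpol hY U a X X'.
have P2 (X : 'M[R]_(dim3 L)) (hX : X^T = X) :=
  Ptilde_herm hphi Vpol hY U hX.
have P3 (X : 'M[R]_(dim3 L)) := Ptilde_psd hphi Vpol hY U X.
have P4 X B : \tr (X *m JD L hphi Vpol Wpol Y B RW) =
    2 * retr (B *m Ptilde hphi Vpol Wpol Y U X).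
  by rewrite /RW -hUW; exact: trace_JD_Ptilde.
have P5 B : B \is hermsymmx ->
    (JD L hphi Vpol Wpol Y B RW)^T = JD L hphi Vpol Wpol Y B RW.
  exact: JD_sym.
have [hJP|nJP] := eqVneq (JP L hphi Vpol Wpol Y)^T (JP L hphi Vpol Wpol Y).
  have sub B d : feasible_A hphi Vpol Wpol Y q P RW B d ->
      feasible_SDR hphi Vpol Wpol Y q P RW B d.
    move=> [h1 h2 h3 h4].
    by have [h5 h6] := projection_SDR_feasible hMT hP h2 h3 h4; split.
  have [B [d [h1 h2 h3 h4 hd]]] := tight hMT hP P1 P2 P4 P5 hJP hLam hgap.
  apply/eqP; rewrite eq_le; apply/andP; split.
    by apply: ereal_inf_le_tmp => v [B' [d' [h ->]]]; exists B', d';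
      split; [exact: sub|].
  apply: (@le_trans _ _ (\sum_l d l)%:E).
    by apply: ereal_inf_lbound; exists B, d; split=> //; split.
  apply: le_ereal_inf_tmp => v [B' [d' [[k1 k2 k3 k4] ->]]].
  rewrite lee_fin hd.
  exact: (weak_duality hMT hP P3 P4 (ltW hgap) k1 k2 k3 k4).
have noJP RV d : psdC RV ->
    ~ (forall l, psdR (lmi_block hphi Vpol Wpol Y q RV RW l (d l))).
  move=> pRV h; move/eqP: nJP; apply.
  have l0 : 'I_(dim3 L) by apply: (@Ordinal _ 0); rewrite addn_gt0 hL.
  have [+ _] := h l0; rewrite /lmi_block tr_block_mx => /eq_block_mx[].
  by rewrite /J linearD /= (P5 _ pRV.1) => /addrI.
by congr ereal_inf; apply/seteqP; split => v [RV [d [[] ]]];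
  [move=> h ? ? ?|move=> h ? ? ?]; case: (@noJP RV d).
Qed.
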